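(* Let $A$ be either $\mathbf{Z}$ or $\mathbf{F}_q[t]$ for some prime power $q$, and let $K$ be its fraction field. Let $f,g \in A[x_1,\dots,x_n]$ be polynomials that are relatively prime as elements of $K[x_1,\dots,x_n]$. Let $$\mathcal{R}_{f,g}:=\{\, a\in A^n : \gcd(f(a),g(a))=1 \,\}.$$ Then $\mu(\mathcal{R}_{f,g})$ exists and equals $\prod_{\mathfrak p} (1 - c_{\mathfrak p}/|\mathfrak p|^n)$, where $\mathfrak p$ ranges over all nonzero primes of $A$, and $c_{\mathfrak p}$ is the number of $x \in (A/\mathfrak p)^n$ satisfying $f(x)=g(x)=0$ in $A/\mathfrak p$.
   Context: For nonzero $a\in A$ let $|a|:=\#(A/aA)$ and $|0|:=0$; for a nonzero prime $\mathfrak p$ of $A$, $|\mathfrak p|:=\#(A/\mathfrak p)$. For real $B_1,\dots,B_n$, define $\mathrm{Box}(B_1,\dots,B_n)=\{(a_1,\dots,a_n)\in\mathbf{Z}^n: 0<a_i\le B_i \text{ for all } i\}$ if $A=\mathbf{Z}$, and $\mathrm{Box}(B_1,\dots,B_n)=\{(a_1,\dots,a_n)\in A^n : |a_i|\le B_i\text{ for all } i\}$ if $A=\mathbf{F}_q[t]$. For $\mathcal S\subseteq A^n$, $\mu(\mathcal S):=\lim_{B_1,\dots,B_n\to\infty}\#(\mathcal S\cap\mathrm{Box})/\#\mathrm{Box}$, where the $B_i$ tend to infinity independently (the claim includes that this limit exists). *)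

(* Defs.v *)
From HB Require Import structures.
From mathcomp Require Import all_boot all_order all_algebra finmap.
From mathcomp Require Import -(notations) mpoly.
From mathcomp Require Import all_classical all_reals all_analysis.
From mathcomp Require Import summability.

Set Implicit Arguments.
Unset Strict Implicit.
Unset Printing Implicit Defensive.

Import Order.TTheory GRing.Theory Num.Theory.
Import numFieldNormedType.Exports.

Local Open Scope classical_set_scope.
Local Open Scope quotient_scope.
Local Open Scope ring_scope.

(* mpoly is imported without its notations, which clash with those of
   mathcomp-analysis. *)
Notation "{ 'mpoly' T [ n ] }" := (mpoly n T)
  (at level 0, T, n at level 2, format "{ 'mpoly'  T [ n ] }") : type_scope.

(* fset_set sends an infinite set to fset0, so the cardinal of an infinite set
   is 0 here. *)
Definition ncard (T : choiceType) (S : set T) : nat := #|` fset_set S|.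

Definition relatively_prime (A : comUnitRingType) (x y : A) : Prop :=
  forall d, (exists u, x = u * d) -> (exists v, y = v * d) -> d \is a GRing.unit.

Definition frac_mpoly (A : idomainType) (n : nat) (f : {mpoly A[n]}) :
  {mpoly {fraction A}[n]} := map_mpoly (@tofrac A) f.

(* A / aA is taken as a set of cosets, since {ideal_quot _} requires a proper
   ideal and a may be a unit. *)
Definition coset_mod (A : comNzRingType) (a x : A) : set A :=
  [set x + a * z | z in [set: A]].

Definition elt_norm (A : comNzRingType) (a : A) : nat :=
  if a == 0 then 0%N else ncard (range (coset_mod a)).

(* By proof irrelevance two elements are equal as soon as they have the same
   members, so each prime occurs once. *)
Definition nzprime (A : comNzRingType) : Type :=
  {p : prime_idealr A | exists2 x : A, x \in p & x != 0}.

Definition residue (A : comNzRingType) (p : nzprime A) : comNzRingType :=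
  {ideal_quot (sval p)}.

Definition prime_norm (A : comNzRingType) (p : nzprime A) : nat :=
  ncard [set: residue p].

Section EulerProduct.
Variables (A : comNzRingType) (n : nat) (f g : {mpoly A[n]}).

Definition eval_mod (p : nzprime A) (h : {mpoly A[n]})
  (x : {ffun 'I_n -> residue p}) : residue p :=
  meval x (map_mpoly (\pi_(residue p)) h).

Definition zeros_mod (p : nzprime A) : nat :=
  ncard [set x : {ffun 'I_n -> residue p} | eval_mod f x = 0 /\ eval_mod g x = 0].

Definition euler_partial (R : realType) (P : {fset {classic nzprime A}}) : R :=
  \prod_(p <- P) (1 - (zeros_mod p)%:R / (prime_norm p)%:R ^+ n).

(* Unconditional convergence: limit along the net of finite sets of primes. The
   limit is allowed to be 0. *)
Definition euler_product_is (R : realType) (l : R) : Prop :=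
  @euler_partial R P @[P --> totally] --> l.
End EulerProduct.

Definition boxZ (R : realType) (n : nat) (B : 'I_n -> R) :
  set {ffun 'I_n -> int} :=
  [set a | forall i, 0 < a i /\ (a i)%:~R <= B i].

Definition boxFqt (F : finFieldType) (R : realType) (n : nat) (B : 'I_n -> R) :
  set {ffun 'I_n -> {poly F}} :=
  [set a | forall i, (elt_norm (a i))%:R <= B i].

(* All the B_i tend to infinity, independently of each other. *)
Definition all_pinfty (R : realType) (n : nat) : set_system ('I_n -> R) :=
  filter_from [set: R] (fun M => [set B | forall i, M <= B i]).

Definition density_is (A : choiceType) (R : realType) (n : nat)
  (box : ('I_n -> R) -> set {ffun 'I_n -> A}) (S : set {ffun 'I_n -> A})
  (l : R) : Prop :=
  (ncard (S `&` box B))%:R / (ncard (box B))%:R @[B --> @all_pinfty R n] --> l.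

(* Main.v *)
(* Both rings are treated at once through a norm with finite residue systems
   (counting_norm).  For a finite set T of primes, the condition "no p in T
   divides both f(a) and g(a)" is periodic, so by the Chinese remainder theorem
   its density is the partial Euler product.  These partial products decrease to
   a limit, and it remains to bound, uniformly in the box, the proportion of
   points at which some prime outside T divides both values (Ekedahl's sieve).

   Order the variables so that the last one, x, has the longest side N; write
   a' for the other coordinates.  If L is a family of polynomials without common
   factor, the ideal of L contains some h <> 0 not involving x.  A prime p dividing all
   l(a', x) divides h(a'), and then either p divides all the coefficients of the
   l(a', .), which are again a family without common factor, in fewer variables;
   or x is one of boundedly many residues mod p.  Primes p > N dividing h(a') are
   boundedly many, because |h(a')| is at most a power of N, and contribute O(1/N);
   primes p <= N contribute O(1/|p|).  The average over a' of the sum of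
   1/|p| over p | h(a') is in turn bounded by induction, looking at the leading
   coefficient of h: primes not dividing it contribute O(1/|p|^2). *)
Require Import Defs.
From HB Require Import structures.
From mathcomp Require Import all_boot all_order all_algebra finmap.
From mathcomp Require Import -(notations) mpoly.
From mathcomp Require Import all_classical all_reals all_analysis.
From mathcomp Require Import summability.
From mathcomp Require Import zify lra.
Import Order.TTheory GRing.Theory Num.Theory.
Import numFieldNormedType.Exports.
Local Open Scope classical_set_scope.
Local Open Scope quotient_scope.
Local Open Scope ring_scope.

Set Implicit Arguments.
Unset Strict Implicit.
Unset Printing Implicit Defensive.

(** * Factorial rings and Gauss' lemma *)

(** The obstacle is that the sum of 1/|p| diverges, and that a residue class modulo p with |p| > N
    can still meet a side of length N: a union bound with a single condition per prime gives
    nothing. Writing h as a combination of the l splits divisibility into two conditions in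
    different variables, p | h(a') and x in few classes modulo p, typically of proportion 1/|p|
    each, and the sum of 1/|p|^2 converges. The variable x needs the longest side because |h(a')| is
    compared with powers of its length. The resulting order of the variables depends on the box, so
    polynomials are rewritten as iterated ones along every permutation, and all bounds are made
    uniform over these finitely many orders. *)

Section Divisibility.
Variable D : idomainType.
Implicit Types p x y : D.

Definition dvr (m x : D) : Prop := exists c, x = c * m.

Definition prime_elt (p : D) : Prop :=
  [/\ p != 0, p \isn't a GRing.unit &
      forall a b, dvr p (a * b) -> dvr p a \/ dvr p b].

Lemma dvr_refl x : dvr x x. Proof. by exists 1; rewrite mul1r. Qed.

Lemma dvr0 x : dvr x 0. Proof. by exists 0; rewrite mul0r. Qed.

Lemma dvrD x a b : dvr x a -> dvr x b -> dvr x (a + b).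
Proof. by move=> [c ->] [d ->]; exists (c + d); rewrite mulrDl. Qed.

Lemma dvrN x a : dvr x a -> dvr x (- a).
Proof. by move=> [c ->]; exists (- c); rewrite mulNr. Qed.

Lemma dvrB x a b : dvr x a -> dvr x b -> dvr x (a - b).
Proof. by move=> xa xb; apply: dvrD => //; apply: dvrN. Qed.

Lemma dvr_mull x c a : dvr x a -> dvr x (c * a).
Proof. by move=> [d ->]; exists (c * d); rewrite mulrA. Qed.

Lemma dvr_mulr x c a : dvr x a -> dvr x (a * c).
Proof. by move=> xa; rewrite mulrC; apply: dvr_mull. Qed.

Lemma dvr_trans y x z : dvr x y -> dvr y z -> dvr x z.
Proof. by move=> xy [c ->]; apply: dvr_mull. Qed.

Lemma dvr_sum x (I : Type) (r : seq I) (P : pred I) (F : I -> D) :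
  (forall i, P i -> dvr x (F i)) -> dvr x (\sum_(i <- r | P i) F i).
Proof. by move=> xF; elim/big_rec: _ => [|i y Pi]; [apply: dvr0 | apply/dvrD/xF]. Qed.

Lemma dvr_prod p (s : seq D) : prime_elt p -> dvr p (\prod_(q <- s) q) ->
  exists2 q, q \in s & dvr p q.
Proof.
move=> [p0 pU pM]; elim: s => [|q s IH]; rewrite ?big_nil ?big_cons.
  by move=> [c c1]; case/negP: pU; apply/unitrPr; exists c; rewrite mulrC.
case/pM => [pq|/IH[r rs pr]]; first by exists q; rewrite ?mem_head.
by exists r => //; rewrite inE rs orbT.
Qed.

Lemma prime_elt_assoc p q : prime_elt p -> prime_elt q -> dvr p q ->
  exists2 v, v \is a GRing.unit & q = v * p.
Proof.
move=> [p0 pU pM] [q0 qU qM] [v qE]; exists v => //.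
have /qM[[c vE]|[c pE]] : dvr q (v * p) by rewrite -qE; apply: dvr_refl.
  case/negP: pU; apply/unitrPr; exists c; rewrite mulrC.
  by apply: (mulIf q0); rewrite mul1r mulrAC -vE -qE.
apply/unitrPr; exists c; apply: (mulIf q0).
by rewrite mul1r -mulrA (mulrC v) mulrAC -mulrA -(mulrC q) mulrA -pE mulrC -qE.
Qed.

(** Asking for prime rather than irreducible factors makes uniqueness automatic. *)
Definition factorial_ring : Prop := forall x, x != 0 ->
  exists u s, [/\ u \is a GRing.unit, {in s, forall p, prime_elt p} &
    x = u * \prod_(p <- s) p].

Lemma dvr_unit x y : y \is a GRing.unit -> dvr x y -> x \is a GRing.unit.
Proof. by move=> yU [c yE]; move: yU; rewrite yE unitrM => /andP[]. Qed.

End Divisibility.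

Lemma dvr_polyC (D : idomainType) (p : D) (f : {poly D}) :
  dvr p%:P f <-> forall i, dvr p f`_i.
Proof.
split=> [[g ->] i|pf]; first by exists g`_i; rewrite coefMC.
have [c cE] := choice pf.
exists (\poly_(i < size f) c i); apply/polyP => i; rewrite coefMC coef_poly.
by case: ltnP => [_|fi]; [exact: cE | rewrite mul0r nth_default].
Qed.

(** Let i and j be the least indices at which [p] fails to divide a coefficient of [f], respectively
    [g]. In the coefficient of index i + j of [f * g], every term except [f_i * g_j] is divisible by
    [p]. *)
Lemma prime_polyC (D : idomainType) (p : D) : prime_elt p -> prime_elt p%:P.
Proof.
move=> [p0 pU pM]; split=> [||f g]; rewrite ?polyC_eq0 //.
  by rewrite poly_unitE coefC size_polyC p0 eqxx.
move=> /dvr_polyC pfg.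
have [pf|/existsNP/cid[i0 npf]] := pselect (forall i, dvr p f`_i).
  by left; apply/dvr_polyC.
have [pg|/existsNP/cid[j0 npg]] := pselect (forall i, dvr p g`_i).
  by right; apply/dvr_polyC.
have exf : exists i, ~~ `[<dvr p f`_i>] by exists i0; apply/asboolPn.
have exg : exists i, ~~ `[<dvr p g`_i>] by exists j0; apply/asboolPn.
case: (ex_minnP exf) => i /asboolPn nfi mini.
case: (ex_minnP exg) => j /asboolPn ngj minj.
have lti : (i < (i + j).+1)%N by rewrite ltnS leq_addr.
have := pfg (i + j)%N; rewrite coefM (bigD1 (Ordinal lti)) //= addKn.
set s := (X in _ + X) => ps.
suff : dvr p s.
  by move/(dvrB ps); rewrite addrK => /pM[].
apply: dvr_sum => k ki; have [ltki|] := ltnP k i.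
  apply: dvr_mulr; apply/asboolP; apply: contraLR ltki => /mini.
  by rewrite -leqNgt.
rewrite leq_eqVlt => /predU1P[ik|ltik].
  by case/eqP: ki; apply/val_inj.
apply: dvr_mull; apply/asboolP; apply/negPn/negP => /minj.
by rewrite leqNgt => /negP; apply; rewrite ltn_subLR ?ltn_add2r // -ltnS.
Qed.

Definition poly_primitive (D : idomainType) (f : {poly D}) : Prop :=
  forall p : D, prime_elt p -> ~ dvr p%:P f.

Lemma primitive_part (D : idomainType) (f : {poly D}) : factorial_ring D -> f != 0 ->
  exists s f', [/\ {in s, forall p : D, prime_elt p}, poly_primitive f' &
    f = (\prod_(p <- s) p)%:P * f'].
Proof.
move=> DF f0.
have [u [s [uU sP]]] := DF _ (etrans (congr1 negb (lead_coef_eq0 f)) f0).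
(* Each prime constant pulled out of [f] removes one prime factor from its leading coefficient, so
   the process stops. *)
elim: {s}(size s) {-2}s (erefl (size s)) u uU sP f f0 => [|n IH] s sn u uU sP f f0 fE.
  exists [::], f; rewrite big_nil mul1r; split=> // p pP /dvr_polyC/(_ (size f).-1).
  rewrite -[f`_ _]/(lead_coef f) fE (size0nil sn) big_nil mulr1 => /(dvr_unit uU).
  by case: pP => _ /negP.
have [prim|/existsNP[p /not_implyP[pP /contrapT[g fg]]]] := pselect (poly_primitive f).
  by exists [::], f; rewrite big_nil mul1r.
have p0 : p != 0 by case: pP.
have g0 : g != 0 by apply: contraNneq f0; rewrite fg => ->; rewrite mul0r.
move: fE; rewrite fg lead_coefM lead_coefC => fE.
have /(dvr_prod pP)[q qs pq] : dvr p (\prod_(p <- s) p).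
  by rewrite -[\prod_(_ <- _) _](mulKr uU) -fE; apply/dvr_mull/dvr_mull/dvr_refl.
have [v vU qE] := prime_elt_assoc pP (sP q qs) pq.
have [||||t [f' [tP f'P gE]]] := IH (rem q s) _ (u * v) _ _ g g0.
- by rewrite size_rem // sn.
- by rewrite unitrM uU.
- by move=> r /mem_rem /sP.
- apply: (mulIf p0); rewrite fE (perm_big _ (perm_to_rem qs)) big_cons /= qE.
  by rewrite -!mulrA; congr (_ * (_ * _)); rewrite mulrC.
exists (p :: t), f'; split=> //.
  by move=> r; rewrite inE => /predU1P[->//|/tP].
by rewrite gE big_cons polyCM [LHS]mulrC mulrA.
Qed.

(** By [prime_polyC] each prime on the left divides [g] or [h] and can be cancelled there. A
    factorisation over the fraction field thus becomes one over [D] with the same degrees. *)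
Lemma strip_product (D : idomainType) (s : seq D) (f g h : {poly D}) :
  {in s, forall p, prime_elt p} -> (\prod_(p <- s) p)%:P * f = g * h ->
  exists g' h', [/\ f = g' * h', size g' = size g & size h' = size h].
Proof.
elim: s f g h => [|p s IH] f g h sP; first by rewrite big_nil mul1r; exists g, h.
have pP : prime_elt p by apply: sP; rewrite mem_head.
have p0 : p%:P != 0 by rewrite polyC_eq0; case: pP.
have sPs : {in s, forall p, prime_elt p} by move=> q qs; apply: sP; rewrite inE qs orbT.
rewrite big_cons polyCM -mulrA => ghE.
have szp k : size (k * p%:P) = size k.
  by rewrite mulrC mul_polyC size_scale //; case: pP.
have [_ _ /(_ g h)[]] := prime_polyC pP.
- by rewrite -ghE mulrC; exists ((\prod_(p <- s) p)%:P * f).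
- move=> [k gE]; have [|g' [h' [fE sg sh]]] := IH f k h sPs.
    by apply: (mulfI p0); rewrite ghE gE (mulrC k) mulrA.
  by exists g', h'; rewrite fE gE szp.
- move=> [k hE]; have [|g' [h' [fE sg sh]]] := IH f g k sPs.
    by apply: (mulfI p0); rewrite ghE hE (mulrC k) mulrCA.
  by exists g', h'; rewrite fE hE szp.
Qed.

(** Over a domain, [%|] is divisibility up to a nonzero constant. The primes of that constant cannot
    divide the primitive [f], so they cancel against the quotient. *)
Lemma primitive_dvd (D : idomainType) (f a : {poly D}) :
  factorial_ring D -> poly_primitive f -> f %| a -> dvr f a.
Proof.
move=> DF fP /Pdiv.Idomain.dvdpP[[c r] /= c0 caE].
have [u [s [uU sP cE]]] := DF c c0.
have {caE} : (\prod_(p <- s) p)%:P * a = (u^-1 *: r) * f.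
  by rewrite -scalerAl -caE mul_polyC scalerA cE mulKr.
move: {r c0 cE}(u^-1 *: r) => r.
elim: s sP r => [|p s IH] sP r; first by rewrite big_nil mul1r => ->; exists r.
have pP : prime_elt p by apply: sP; rewrite mem_head.
have p0 : p%:P != 0 by rewrite polyC_eq0; case: pP.
rewrite big_cons polyCM -mulrA => rfE.
have [_ _ /(_ r f)[]] := prime_polyC pP.
- by rewrite -rfE mulrC; exists ((\prod_(p <- s) p)%:P * a).
- move=> [k rE]; apply: (IH _ k).
    by move=> q qs; apply: sP; rewrite inE qs orbT.
  by apply: (mulfI p0); rewrite rfE rE (mulrC k) mulrA.
- by move/(fP p pP).
Qed.

Lemma factorial_poly (D : idomainType) : factorial_ring D -> factorial_ring {poly D}.
Proof.
move=> DF f; elim: {f}(size f) {-2}f (leqnn (size f)) => [|m IH] f fm f0.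
  by move: fm; rewrite leqn0 size_poly_eq0 (negbTE f0).
have [s [f' [sP f'P fE]]] := primitive_part DF f0.
have c0 : \prod_(p <- s) p != 0.
  by apply: contraNneq f0; rewrite fE => ->; rewrite polyC0 mul0r.
have f'0 : f' != 0 by apply: contraNneq f0; rewrite fE => ->; rewrite mulr0.
have szf : size f = size f' by rewrite fE mul_polyC size_scale.
suff [u [t [uU tP f'E]]] : exists u t, [/\ u \is a GRing.unit,
    {in t, forall p, prime_elt p} & f' = u * \prod_(p <- t) p].
  exists u, (map polyC s ++ t); split=> //.
    move=> q; rewrite mem_cat => /orP[/mapP[p /sP pP ->]|/tP//].
    exact: prime_polyC.
  by rewrite big_cat big_map /= fE f'E rmorph_prod /= mulrCA.
have [f'1|f'1] := eqVneq (size f') 1%N.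
  move/eqP/size_poly1P: f'1 => [c cn0 f'E].
  have [u [t [uU tP cE]]] := DF c cn0.
  exists u%:P, (map polyC t); split.
  - by rewrite poly_unitE coefC size_polyC eqxx uU (contraTneq _ uU) // => ->; rewrite unitr0.
  - by move=> q /mapP[p /tP pP ->]; apply: prime_polyC.
  - by rewrite big_map f'E cE polyCM rmorph_prod.
have [[g [h [f'E gs hs]]]|nred] := pselect (exists g h : {poly D},
    [/\ f' = g * h, (size g < size f')%N & (size h < size f')%N]).
  have gh0 : (g != 0) && (h != 0) by rewrite -negb_or -mulf_eq0 -f'E.
  case/andP: gh0 => g0 h0.
  have [|u1 [t1 [u1U t1P gE]]] := IH g _ g0.
    by rewrite -ltnS (leq_trans gs) // -szf.
  have [|u2 [t2 [u2U t2P hE]]] := IH h _ h0.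
    by rewrite -ltnS (leq_trans hs) // -szf.
  exists (u1 * u2), (t1 ++ t2); split; rewrite ?unitrM ?u1U //.
    by move=> p; rewrite mem_cat => /orP[/t1P|/t2P].
  by rewrite f'E gE hE big_cat /= mulrACA.
have f'gt1 : (1 < size f')%N.
  by rewrite ltn_neqAle eq_sym f'1 lt0n size_poly_eq0.
(* A divisor over the fraction field gives, by [strip_product], a true factor of the same size;
   unless it is associate to [f'] this contradicts [nred]. *)
have irr : irreducible_poly f'.
  split=> // q q1 qf'.
  have [[c r] /= cn0 rqE] := Pdiv.Idomain.dvdpP _ _ qf'.
  have [u [t [uU tP cE]]] := DF c cn0.
  have [|r' [q' [f'E sr' sq']]] := @strip_product _ t f' (u^-1 *: r) q tP.
    by rewrite -scalerAl -rqE mul_polyC scalerA cE mulKr.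
  rewrite -(dvdp_size_eqp qf') eqn_leq dvdp_leq //= leqNgt -sq'; apply/negP => q'f'.
  case: nred; exists r', q'; split=> //.
  have rq0 : (r' != 0) && (q' != 0) by rewrite -negb_or -mulf_eq0 -f'E.
  case/andP: rq0 => r'0 q'0.
  rewrite f'E size_mul // -subn1 ltn_subRL addnC.
  rewrite ltn_add2l ltn_neqAle eq_sym sq' q1 -sq' lt0n size_poly_eq0 //.
exists 1, [:: f']; split; rewrite ?unitr1 ?big_seq1 ?mul1r //.
move=> p; rewrite inE => /eqP->; split=> //.
  by rewrite poly_unitE (negbTE f'1).
(* Irreducibility makes [f'] prime for [%|], and [primitive_dvd] brings this back to [dvr]. *)
move=> a b [c abE].
have f'ab : f' %| a * b by rewrite abE dvdp_mull.
have [cop|ncop] := boolP (coprimep f' a).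
  by right; apply: (primitive_dvd DF f'P); rewrite -(Gauss_dvdpr _ cop).
left; apply: (primitive_dvd DF f'P).
have := irr.2 _ ncop (dvdp_gcdl _ _); rewrite eqp_sym => /eqp_dvdl ->.
exact: dvdp_gcdr.
Qed.

(** A bare predicate is enough: the sieve uses the polynomials whose value at a given point lies in
    a given prime. *)
Definition ideal_pred (D : pzRingType) (J : D -> Prop) : Prop :=
  [/\ J 0, forall a b, J a -> J b -> J (a + b) & forall c a, J a -> J (c * a)].

Lemma list_bezout (D : idomainType) (L : seq {poly D}) : exists g : {poly D},
  {in L, forall l, g %| l} /\
  forall J, ideal_pred J -> (forall l, l \in L -> J l) -> J g.
Proof.
elim: L => [|l L [g [gL gJ]]]; first by exists 0; split=> // J [].
have [[u v] /= uvE] := Bezoutp l g.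
exists (u * l + v * g); split=> [k|J JI JL].
  rewrite inE => /predU1P[->|/gL gk]; rewrite (eqp_dvdl _ uvE) ?dvdp_gcdl //.
  exact: dvdp_trans (dvdp_gcdr _ _) gk.
have [_ JD JM] := JI; apply: JD; apply: JM; first by apply: JL; rewrite mem_head.
by apply: gJ => // k kL; apply: JL; rewrite inE kL orbT.
Qed.

(* Gauss' lemma turns the coprimality of [L] over [D] into coprimality over the
   fraction field of [D], where a Bezout relation is available; [h] clears its
   denominators. *)
Lemma const_in_ideal (D : idomainType) (L : seq {poly D}) : factorial_ring D ->
  (forall d, {in L, forall l, dvr d l} -> size d = 1%N) ->
  exists2 h : D, h != 0 &
    forall J, ideal_pred J -> (forall l, l \in L -> J l) -> J h%:P.
Proof.
move=> DF Lcop; have [g [gL gJ]] := list_bezout L.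
have g0 : g != 0.
  apply/eqP => g0; have := Lcop 0; rewrite size_poly0 => H.
  suff : 0%N = 1%N by []; apply: H => l /gL.
  by rewrite g0 dvd0p => /eqP->; apply: dvr0.
have [s [g' [sP g'P gE]]] := primitive_part DF g0.
have g'1 : size g' = 1%N.
  apply: Lcop => l /gL gl; apply: (primitive_dvd DF g'P).
  by apply: dvdp_trans gl; rewrite gE dvdp_mull.
move/eqP/size_poly1P: g'1 => [c c0 g'E]; exists ((\prod_(p <- s) p) * c).
  by rewrite mulf_neq0 // (contraNneq _ g0) // gE => ->; rewrite polyC0 mul0r.
by move=> J JI JL; rewrite polyCM -g'E -gE; apply: gJ.
Qed.

(** * Nonzero prime ideals and norms *)

Section PrimeIdeals.
Variable A : idomainType.
Implicit Types (p q : nzprime A) (x y : A).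

Definition in_prime p x : bool := x \in sval p.

Lemma in_prime0 p : in_prime p 0.
Proof. exact: rpred0. Qed.

Lemma in_primeD p x y : in_prime p x -> in_prime p y -> in_prime p (x + y).
Proof. exact: rpredD. Qed.

Lemma in_primeB p x y : in_prime p x -> in_prime p y -> in_prime p (x - y).
Proof. exact: rpredB. Qed.

Lemma in_primeM p x y : in_prime p (x * y) = in_prime p x || in_prime p y.
Proof. exact: prime_idealrM. Qed.

Lemma in_prime1 p : in_prime p 1 = false.
Proof. exact: idealr1. Qed.

Lemma in_prime_dvr p x y : dvr x y -> in_prime p x -> in_prime p y.
Proof. by move=> [c ->] px; rewrite in_primeM px orbT. Qed.

Lemma nzprime_eq p q : in_prime p =1 in_prime q -> p = q.
Proof.
case: p q => [[P [[P1] [P2] [P3] [P4]]] Pn] [[Q [[Q1] [Q2] [Q3] [Q4]]] Qn].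
rewrite /in_prime /= => PQ.
have {}PQ : P = Q by apply/funext.
subst Q; move: Pn Qn; rewrite (Prop_irrelevance P1 Q1) (Prop_irrelevance P2 Q2).
rewrite (Prop_irrelevance P3 Q3) (Prop_irrelevance P4 Q4) => Pn Qn.
by rewrite (Prop_irrelevance Pn Qn).
Qed.

Section PrimeOf.
Variables (pi : A) (piP : prime_elt pi).

Definition multiples : {pred A} := fun x => `[<dvr pi x>].

Lemma multiples_zmod : zmod_closed multiples.
Proof.
split=> [|x y]; first by rewrite unfold_in; apply/asboolP; apply: dvr0.
by move=> /asboolP xp /asboolP yp; apply/asboolP; exact: dvrB.
Qed.

Lemma multiples_proper : ring_quotient.proper_ideal multiples.
Proof.
split.
  apply/negP => /asboolP/(dvr_unit (unitr1 A)); case: piP => _ /negP pU _.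
  exact: pU.
by move=> a x /asboolP xp; apply/asboolP; exact: dvr_mull.
Qed.

Lemma multiples_prime : prime_idealr_closed multiples.
Proof.
move=> u v /asboolP; case: piP => _ _ /[apply] -[] H; apply/orP.
  by left; apply/asboolP.
by right; apply/asboolP.
Qed.

HB.instance Definition _ := GRing.isZmodClosed.Build A multiples multiples_zmod.
HB.instance Definition _ := isProperIdeal.Build A multiples multiples_proper.
HB.instance Definition _ := isPrimeIdealrClosed.Build A multiples multiples_prime.

Lemma prime_of_subproof : exists2 x : A, x \in (multiples : prime_idealr A) & x != 0.
Proof. by exists pi; [apply/asboolP; exact: dvr_refl | case: piP]. Qed.

Definition prime_of : nzprime A := exist _ (multiples : prime_idealr A) prime_of_subproof.

Lemma in_prime_of x : in_prime prime_of x <-> dvr pi x.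
Proof. by split => /asboolP. Qed.

End PrimeOf.
End PrimeIdeals.

Lemma ncard_seq (T : choiceType) (S : set T) (s : seq T) :
  uniq s -> (forall x, S x <-> x \in s) -> ncard S = size s.
Proof.
move=> us Ss; have -> : S = [set` s] by apply/seteqP; split=> x /Ss.
rewrite /ncard -[in RHS](undup_id us) -card_fseq; congr #|` _|.
by apply/fsetP => x; rewrite in_fset_set // inE; apply/idP/idP; rewrite ?inE.
Qed.

(** [nrm_residues] identifies the norm with the index of mA; [nrmD] bounds values of polynomials by
    powers of the side; [nrm_count] makes the sum of 1/|p|^2 converge; [nrm_gt1] provides a nonunit,
    hence a prime, so that (0, 0) is not coprime. *)
Record counting_norm (A : idomainType) (nrm : A -> nat) : Prop := CountingNorm {
  nrm_eq0 : forall x, (nrm x == 0%N) = (x == 0);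
  nrmM : forall x y, nrm (x * y) = (nrm x * nrm y)%N;
  nrmD : forall x y : A, (nrm (x + y)%R <= nrm x + nrm y)%N;
  nrm1_unit : forall x, nrm x = 1%N -> x \is a GRing.unit;
  nrm_bezout : forall a b : A, exists u v,
    dvr (u * a + v * b) a /\ dvr (u * a + v * b) b;
  nrm_residues : forall m : A, m != 0 -> exists rs, [/\ uniq rs, size rs = nrm m,
    forall x, exists2 r, r \in rs & dvr m (x - r) &
    {in rs &, forall r r', dvr m (r - r') -> r = r'}];
  nrm_count : exists2 C, (0 < C)%N & forall X (s : seq A), (0 < X)%N -> uniq s ->
    {in s, forall x, nrm x <= X}%N -> (size s <= C * X)%N;
  nrm_gt1 : exists x, (1 < nrm x)%N }.

Section CountingNorm.
Variables (A : idomainType) (nrm : A -> nat).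
Hypothesis CN : counting_norm nrm.
Implicit Types (p q : nzprime A) (x y m : A).

Lemma nrm_gt0 x : (0 < nrm x)%N = (x != 0).
Proof. by rewrite lt0n (nrm_eq0 CN). Qed.

Lemma nrm0 : nrm 0 = 0%N.
Proof. by apply/eqP; rewrite (nrm_eq0 CN). Qed.

Lemma nrm_unit x : x \is a GRing.unit -> nrm x = 1%N.
Proof.
have nrm1 : nrm 1 = 1%N.
  apply/eqP; rewrite -(eqn_pmul2l (_ : 0 < nrm 1)%N); last by rewrite nrm_gt0 oner_eq0.
  by rewrite -(nrmM CN) mulr1 muln1.
by move=> /divrr xU; move: nrm1; rewrite -xU (nrmM CN) => /eqP; rewrite muln_eq1 => /andP[/eqP].
Qed.

Lemma nrm_dvr m x : x != 0 -> dvr m x -> (nrm m <= nrm x)%N.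
Proof.
move=> + [c xE]; rewrite xE mulf_eq0 => /norP[c0 m0].
by rewrite (nrmM CN) leq_pmull // nrm_gt0.
Qed.

(** Norms are multiplicative, so proper factors have smaller norm; an element without proper
    factorisation is prime by Bezout. *)
Lemma factorial_nrm : factorial_ring A.
Proof.
move=> x; elim: {x}(nrm x) {-2}x (leqnn (nrm x)) => [|n IH] x xn x0.
  by move: xn; rewrite leqn0 (nrm_eq0 CN) (negbTE x0).
have [xU|xU] := boolP (x \is a GRing.unit).
  by exists x, [::]; rewrite big_nil mulr1.
have [[y [z [yU zU xE]]]|irr] := pselect (exists y z,
    [/\ y \isn't a GRing.unit, z \isn't a GRing.unit & x = y * z]).
  have yz0 : (y != 0) && (z != 0) by rewrite -negb_or -mulf_eq0 -xE.
  case/andP: yz0 => y0 z0.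
  have gt1 w : w != 0 -> w \isn't a GRing.unit -> (1 < nrm w)%N.
    move=> w0 wU; rewrite ltn_neqAle nrm_gt0 w0 andbT eq_sym.
    by apply: contraNneq wU => /(nrm1_unit CN).
  have [|u1 [s1 [u1U s1P yE]]] := IH y _ y0.
    rewrite -ltnS (leq_trans _ xn) // xE (nrmM CN) ltn_Pmulr ?gt1 //.
    by rewrite nrm_gt0.
  have [|u2 [s2 [u2U s2P zE]]] := IH z _ z0.
    rewrite -ltnS (leq_trans _ xn) // xE (nrmM CN) ltn_Pmull ?gt1 //.
    by rewrite nrm_gt0.
  exists (u1 * u2), (s1 ++ s2); split; rewrite ?unitrM ?u1U //.
    by move=> p; rewrite mem_cat => /orP[/s1P|/s2P].
  by rewrite xE yE zE big_cat /= mulrACA.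
exists 1, [:: x]; split; rewrite ?unitr1 ?big_seq1 ?mul1r //.
move=> p; rewrite inE => /eqP->; split=> // a b xab.
have [u [v [[c xE] da]]] := nrm_bezout CN x a.
have [dU|dU] := boolP (u * x + v * a \is a GRing.unit).
  right; rewrite -(mulKr dU b); apply: dvr_mull.
  rewrite mulrDl -!mulrA; apply: dvrD; apply: dvr_mull => //.
  by apply: dvr_mulr; apply: dvr_refl.
left; apply: dvr_trans da; have [cU|cU] := boolP (c \is a GRing.unit).
  by exists c^-1; rewrite [X in c^-1 * X]xE mulKr.
by case: irr; exists c, (u * x + v * a).
Qed.

(** The generator is a nonzero element of least norm: its gcd with any other element of [p] lies in
    [p], so has no smaller norm and is associate to it. *)
Lemma nzprime_principal p : exists pi, forall x, in_prime p x <-> dvr pi x.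
Proof.
have [x px x0] := svalP p.
have : exists n, `[<exists x, [/\ in_prime p x, x != 0 & nrm x = n]>].
  by exists (nrm x); apply/asboolP; exists x.
move=> /ex_minnP[n /asboolP[pi [ppi pi0 npi]] min].
exists pi => y; split=> [py|/in_prime_dvr]; last exact.
have [u [v [[c piE] dy]]] := nrm_bezout CN pi y.
apply: dvr_trans dy; set d := u * pi + _ in piE *.
have d0 : d != 0 by apply: contraNneq pi0; rewrite piE => ->; rewrite mulr0.
have le : (nrm pi <= nrm d)%N.
  rewrite npi; apply: min; apply/asboolP; exists d; split=> //.
  by apply: in_primeD; rewrite in_primeM ?ppi ?py orbT.
have cU : c \is a GRing.unit.
  apply: (nrm1_unit CN); apply/eqP; rewrite eqn_leq nrm_gt0.
  rewrite -(leq_pmul2r (_ : 0 < nrm d)%N) ?nrm_gt0 //.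
  rewrite -(nrmM CN) -piE mul1n le; apply: contraNneq pi0.
  by rewrite piE => ->; rewrite mul0r.
by exists c^-1; rewrite piE mulKr.
Qed.

Definition gen p : A := projT1 (cid (nzprime_principal p)).

Lemma in_primeP p x : in_prime p x <-> dvr (gen p) x.
Proof. exact: (projT2 (cid (nzprime_principal p))). Qed.

Lemma in_prime_gen p : in_prime p (gen p).
Proof. by apply/in_primeP/dvr_refl. Qed.

Lemma gen_neq0 p : gen p != 0.
Proof.
have [x px x0] := svalP p; apply: contraNneq x0 => g0.
by have /in_primeP[c ->] := px; rewrite g0 mulr0.
Qed.

Lemma nrm_gen_gt1 p : (1 < nrm (gen p))%N.
Proof.
rewrite ltn_neqAle nrm_gt0 gen_neq0 andbT eq_sym; apply/eqP => /(nrm1_unit CN) gU.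
suff : in_prime p 1 by rewrite in_prime1.
by rewrite -(divrr gU) in_primeM in_prime_gen.
Qed.

(** This is the maximality of nonzero primes in a principal ideal domain. *)
Lemma gen_notin p q : p != q :> {classic nzprime A} -> in_prime q (gen p) = false.
Proof.
move=> pq; apply/negP => /in_primeP[c pE].
have := in_prime_gen p; rewrite [in X in X -> _]pE in_primeM => /orP[/in_primeP[d cE]|pq'].
  have : in_prime q 1.
    apply/in_primeP; exists d; apply: (mulIf (gen_neq0 p)).
    by rewrite mul1r {1}pE cE mulrAC.
  by rewrite in_prime1.
case/eqP: pq; apply: nzprime_eq => x; apply/idP/idP.
  by move/in_primeP => [d ->]; rewrite pE !in_primeM in_prime_gen !orbT.
by move/in_primeP => [d ->]; rewrite in_primeM pq' orbT.
Qed.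

Lemma gen_inj : injective (gen : {classic nzprime A} -> A).
Proof.
move=> p q pq; apply/eqP/negP => /negP/gen_notin.
by rewrite pq in_prime_gen.
Qed.

(** [phi] stands for both models of the quotient: the cosets of [elt_norm] and the ideal quotient of
    [prime_norm]. *)
Lemma ncard_residues (T : choiceType) (phi : A -> T) m : m != 0 ->
  (forall x y, phi x = phi y <-> dvr m (x - y)) -> ncard (range phi) = nrm m.
Proof.
move=> m0 phiE; have [rs [urs <- rsE rsI]] := nrm_residues CN m0.
rewrite -(size_map phi); apply: ncard_seq.
  by rewrite map_inj_in_uniq // => x y xr yr /phiE; apply: rsI.
move=> t; split=> [[x _ <-]|/mapP[r rr ->]]; last by exists r.
by have [r rr /phiE ->] := rsE x; apply: map_f.
Qed.

Lemma elt_normE x : elt_norm x = nrm x.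
Proof.
rewrite /elt_norm; case: eqP => [->|/eqP x0]; first by rewrite nrm0.
apply: ncard_residues => // a b; split=> [|[c abE]].
  move/seteqP => [+ _] => /(_ a)[|z _ /(canRL (addKr _)) azE].
    by exists 0; rewrite ?mulr0 ?addr0.
  by exists z; rewrite mulrC azE addrC.
apply/seteqP; split=> _ [z _ <-].
  by exists (c + z) => //; rewrite mulrDr mulrC -abE addrA addrCA subrr addr0.
by exists (z - c) => //; rewrite mulrBr (mulrC x c) -abE opprB addrCA (addrC a) subrK addrC.
Qed.

Lemma coprime_no_prime x y :
  (exists u v, u * x + v * y = 1) <-> ~ exists p, in_prime p x /\ in_prime p y.
Proof.
split=> [[u [v uv1]] [p [px py]]|nopr].
  suff : in_prime p 1 by rewrite in_prime1.
  by rewrite -uv1; apply: in_primeD; rewrite in_primeM ?px ?py orbT.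
have [u [v [dx dy]]] := nrm_bezout CN x y; set d := u * x + _ in dx dy.
have [dU|dU] := boolP (d \is a GRing.unit).
  by exists (d^-1 * u), (d^-1 * v); rewrite -!mulrA -mulrDr mulVr.
suff [pi piP pid] : exists2 pi, prime_elt pi & dvr pi d.
  case: nopr; exists (prime_of piP).
  by split; apply/(in_prime_of piP); [apply: dvr_trans dx | apply: dvr_trans dy].
have [d0|d0] := eqVneq d 0; last first.
  have [w [[|p s] [wU sP dE]]] := factorial_nrm d0.
    by move: dU; rewrite dE big_nil mulr1 wU.
  exists p; first by apply: sP; rewrite mem_head.
  by rewrite dE big_cons; apply/dvr_mull/dvr_mulr/dvr_refl.
(* If the gcd is 0, both elements vanish and any prime will do; a factor of an element of norm above
   1 provides one. *)
have [x0 x0n] := nrm_gt1 CN; have x00 : x0 != 0 by rewrite -nrm_gt0 ltnW.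
have [w [[|p s] [wU sP xE]]] := factorial_nrm x00.
  by move: x0n; rewrite xE big_nil mulr1 (nrm_unit wU).
by exists p; [apply: sP; rewrite mem_head | rewrite d0; apply: dvr0].
Qed.

Lemma prime_normE p : prime_norm p = nrm (gen p).
Proof.
rewrite /prime_norm -(ncard_residues (phi := \pi_(residue p)) (gen_neq0 p)).
  congr ncard; apply/seteqP; split=> // x _; exists (repr x) => //.
  exact: reprK.
move=> x y; rewrite -in_primeP; rewrite /in_prime Quotient.idealrBE.
by split => /eqP.
Qed.

End CountingNorm.

(** * Iterated polynomial rings and averages over boxes *)

Fixpoint ipoly (A : idomainType) (k : nat) : idomainType :=
  if k is k'.+1 then ({poly (ipoly A k')} : idomainType) else A.

(* The point [bs] lists the outermost variable first. *)
Fixpoint gev (A : idomainType) (B : comNzRingType) (iota : {rmorphism A -> B}) (k : nat)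
    (bs : seq B) : {rmorphism ipoly A k -> B} :=
  match k with
  | 0 => iota
  | k'.+1 => (horner_eval (head 0 bs) \o map_poly (gev iota k' (behead bs))
              : {rmorphism {poly (ipoly A k')} -> B})
  end.

Notation ev a h := (gev idfun _ a h).

Fixpoint icst (A : idomainType) (k : nat) : {rmorphism A -> ipoly A k} :=
  match k with
  | 0 => idfun
  | k'.+1 => (polyC \o icst A k' : {rmorphism A -> {poly ipoly A k'}})
  end.

Fixpoint ivars (A : idomainType) (k : nat) : seq (ipoly A k) :=
  match k with
  | 0 => [::]
  | k'.+1 => ('X : {poly ipoly A k'}) :: map (polyC : ipoly A k' -> {poly ipoly A k'}) (ivars A k')
  end.

Section Gev.
Variables (A : idomainType) (B : comNzRingType) (iota : {rmorphism A -> B}).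

Lemma gevS k b bs (h : ipoly A k.+1) :
  gev iota k.+1 (b :: bs) h = (map_poly (gev iota k bs) (h : {poly ipoly A k})).[b].
Proof. by []. Qed.

Lemma gevC k bs (c : ipoly A k) :
  gev iota k.+1 bs (c%:P : {poly ipoly A k}) = gev iota k (behead bs) c.
Proof. by rewrite /= map_polyC /horner_eval /= hornerC. Qed.

Lemma gevX k bs : gev iota k.+1 bs ('X : {poly ipoly A k}) = head 0 bs.
Proof. by rewrite /= /horner_eval map_polyX hornerX. Qed.

Lemma gev_cst k bs c : gev iota k bs (icst A k c) = iota c.
Proof. by elim: k bs => [|k IH] bs //; rewrite [icst _ _ _]/= gevC IH. Qed.

Lemma gev_ext (iota' : {rmorphism A -> B}) k bs :
  iota =1 iota' -> gev iota k bs =1 gev iota' k bs.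
Proof.
move=> ext; elim: k bs => [|k IH] bs h //=.
by rewrite (eq_map_poly (IH _)).
Qed.

Lemma gev_vars k bs : size bs = k -> map (gev iota k bs) (ivars A k) = bs.
Proof.
elim: k bs => [|k IH] [|b bs] // [sb]; rewrite [ivars _ _]/= map_cons gevX /=.
congr cons; rewrite -map_comp -[RHS](IH bs sb); apply: eq_map => c /=.
by rewrite /horner_eval map_polyC /= hornerC.
Qed.

End Gev.

Lemma gev_comp (A : idomainType) (B C : comNzRingType) (iota : {rmorphism A -> B})
    (phi : {rmorphism B -> C}) k bs h :
  phi (gev iota k bs h) = gev (phi \o iota) k (map phi bs) h.
Proof.
elim: k bs h => [|k IH] bs h //=.
rewrite /horner_eval -horner_map -map_poly_comp /=.
have -> : head 0 (map phi bs) = phi (head 0 bs) by case: bs => //=; rewrite rmorph0.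
congr (_.[_]); apply: eq_map_poly => c /=; rewrite IH.
by case: bs.
Qed.

Lemma gev_id (A : idomainType) k h : gev (icst A k) k (ivars A k) h = h.
Proof.
elim: k h => [|k IH] h //; rewrite gevS -[RHS]comp_polyXr; congr (_.[_]).
apply: eq_map_poly => c /=; rewrite -[in RHS](IH c).
by rewrite -[in RHS]/(polyC _) gev_comp; apply: gev_ext.
Qed.

Lemma rmorph_mmap (n : nat) (A B C : comNzRingType) (iota : {rmorphism A -> B})
    (phi : {rmorphism B -> C}) (h : 'I_n -> B) (f : {mpoly A[n]}) :
  phi (mmap iota h f) = mmap (phi \o iota) (phi \o h) f.
Proof.
rewrite /mmap rmorph_sum; apply: eq_bigr => m _ /=.
rewrite rmorphM /mmap1 rmorph_prod; congr (_ * _).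
by apply: eq_bigr => i _; rewrite rmorphXn.
Qed.

Lemma eq_mmap (n : nat) (A B : nzRingType) (i1 i2 : A -> B)
    (h1 h2 : 'I_n -> B) (f : {mpoly A[n]}) : i1 =1 i2 -> h1 =1 h2 ->
  mmap i1 h1 f = mmap i2 h2 f.
Proof.
move=> ei eh; apply: eq_bigr => m _; rewrite ei; congr (_ * _).
exact: mmap1_eq.
Qed.

(** * From multivariate to iterated polynomials *)

Section Unpack.
Variables (A : idomainType) (n : nat) (e : seq 'I_n).
Hypotheses (ue : uniq e) (me : forall i, i \in e).

Lemma size_enumeration : size e = n.
Proof.
by rewrite -[RHS](size_enum_ord n); apply/perm_size/uniq_perm; rewrite ?enum_uniq // => i; rewrite mem_enum me.
Qed.

(** The order [e] of the variables is left free; it is chosen once the box is known, the longest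
    side coming first. *)
Definition unpack (f : {mpoly A[n]}) : ipoly A n :=
  mmap (icst A n) (fun i => nth 0 (ivars A n) (index i e)) f.

Lemma size_ivars k : size (ivars A k) = k.
Proof. by elim: k => //= k IH; rewrite size_map IH. Qed.

Lemma gev_unpack (B : comNzRingType) (iota : {rmorphism A -> B}) bs f : size bs = n ->
  gev iota n bs (unpack f) = mmap iota (fun i => nth 0 bs (index i e)) f.
Proof.
move=> sb; rewrite rmorph_mmap; apply: eq_mmap => [c|i] /=; first exact: gev_cst.
rewrite -[in RHS](gev_vars iota sb) (nth_map 0) // size_ivars.
by rewrite -[X in (_ < X)%N]size_enumeration index_mem.
Qed.

Lemma ev_unpack a f : size a = n ->
  ev a (unpack f) = meval (fun i => nth 0 a (index i e)) f.
Proof. exact: gev_unpack. Qed.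

(** [unpack] has an inverse morphism [pack], which carries [d] to a common divisor of [f] and [g].
    Over the fraction field it is a unit, hence a constant, though not necessarily a unit of [A]. *)
Lemma unpack_coprime (f g : {mpoly A[n]}) :
  relatively_prime (frac_mpoly f) (frac_mpoly g) ->
  forall d, dvr d (unpack f) -> dvr d (unpack g) ->
  exists2 c, c != 0 & d = icst A n c.
Proof.
move=> fg d [u uE] [v vE].
pose pack : {rmorphism ipoly A n -> {mpoly A[n]}} :=
  gev (mpolyC n (R:=A)) n [seq mpolyX A (mnm1 i) | i <- e].
have packK h : pack (unpack h) = h.
  rewrite gev_unpack; last by rewrite size_map size_enumeration.
  rewrite [RHS]mpolyE; apply: eq_bigr => m _.
  rewrite -mul_mpolyC; congr (_ * _); rewrite -mmap1_id; apply: mmap1_eq => i.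
  by rewrite (nth_map i) ?index_mem // nth_index.
have unpackK k : unpack (pack k) = k.
  rewrite -[unpack]/(mmap _ _) gev_comp -[RHS]gev_id -map_comp.
  rewrite (gev_ext (iota' := icst A n)); last first.
    by move=> c /=; rewrite mmapC.
  congr (gev _ _ _ _); apply: (@eq_from_nth _ 0).
    by rewrite size_map size_enumeration size_ivars.
  rewrite size_map => i ie; have e0 : 'I_n by case: (e) ie.
  by rewrite (nth_map e0) //= mmapX mmap1U index_uniq.
have : frac_mpoly (pack d) \is a GRing.unit.
  apply: fg; [exists (frac_mpoly (pack u)) | exists (frac_mpoly (pack v))].
    by rewrite /frac_mpoly -[in LHS](packK f) uE !rmorphM.
  by rewrite /frac_mpoly -[in LHS](packK g) vE !rmorphM.
move=> /andP[/eqP dC dU].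
exists (mcoeff mnm0 (pack d)).
  by apply: contraTneq dU => d0; rewrite mcoeff_map_mpoly d0 raddf0 unitr0.
have -> : icst A n (mcoeff mnm0 (pack d)) = unpack (mpolyC n (mcoeff mnm0 (pack d))).
  by rewrite /unpack mmapC.
rewrite -[LHS]unpackK; congr unpack; apply/mpolyP => m; rewrite mcoeffC.
apply/eqP; rewrite -tofrac_eq -[tofrac _](mcoeff_map_mpoly (@tofrac A)).
rewrite [map_mpoly _ _]dC mcoeffC rmorphM mcoeff_map_mpoly.
by rewrite rmorph_nat.
Qed.

End Unpack.

(** * Iterated averages over boxes *)

Section Expectation.
Variable R : realType.
Variable T : Type.
Implicit Types (s : seq T) (bs : seq (seq T)).

Definition avg s (F : T -> R) : R := (\sum_(x <- s) F x) / (size s)%:R.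

(** The head coordinate is averaged first, the others being fixed: a one-variable estimate bounds
    the inner average, and the induction hypothesis handles what remains. *)
Fixpoint expect bs (F : seq T -> R) : R :=
  if bs is s :: bs' then expect bs' (fun a => avg s (fun x => F (x :: a))) else F [::].

End Expectation.

Lemma natr_count (R : pzSemiRingType) (T : Type) (s : seq T) (P : pred T) :
  \sum_(x <- s) (P x)%:R = (count P s)%:R :> R.
Proof.
by rewrite -sum1_count natr_sum [RHS]big_mkcond; apply: eq_bigr => x _; case: (P x).
Qed.

Section AvgTheory.
Variables (R : realType) (T : eqType).
Implicit Types (s : seq T) (bs : seq (seq T)).

Lemma le_avg s (F G : T -> R) : {in s, forall x, F x <= G x} -> avg s F <= avg s G.
Proof.
move=> FG; apply: ler_wpM2r; first by rewrite invr_ge0.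
by rewrite !big_seq; apply: ler_sum.
Qed.

Lemma eq_avg s (F G : T -> R) : {in s, F =1 G} -> avg s F = avg s G.
Proof. by move=> FG; congr (_ / _); apply: eq_big_seq. Qed.

Lemma avgD s (F G : T -> R) : avg s (fun x => F x + G x) = avg s F + avg s G.
Proof. by rewrite /avg big_split mulrDl. Qed.

Lemma avgZ s (c : R) (F : T -> R) : avg s (fun x => c * F x) = c * avg s F.
Proof. by rewrite /avg -mulr_sumr mulrA. Qed.

Lemma avg_sum s (I : Type) (r : seq I) (P : pred I) (F : I -> T -> R) :
  avg s (fun x => \sum_(i <- r | P i) F i x) = \sum_(i <- r | P i) avg s (F i).
Proof. by rewrite /avg exchange_big mulr_suml. Qed.

Lemma avg_cst s (c : R) : (0 < size s)%N -> avg s (fun=> c) = c.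
Proof.
move=> s0; rewrite /avg big_const_seq count_predT iter_addr_0 -[c *+ _]mulr_natr mulfK //.
by rewrite pnatr_eq0 -lt0n.
Qed.

Lemma avg_count s (P : pred T) : avg s (fun x => (P x)%:R : R) = (count P s)%:R / (size s)%:R.
Proof.
by rewrite /avg natr_count.
Qed.

Definition inbox bs (a : seq T) := all2 (fun (s : seq T) x => x \in s) bs a.

Lemma size_inbox bs a : inbox bs a -> size a = size bs.
Proof. by elim: bs a => [|S bs IH] [|x a] //= /andP[_ /IH ->]. Qed.

Lemma le_expect bs (F G : seq T -> R) :
  (forall a, inbox bs a -> F a <= G a) -> expect bs F <= expect bs G.
Proof.
elim: bs F G => [|S bs IH] F G FG /=; first exact: FG.
by apply: IH => a ab; apply: le_avg => x xS; apply: FG; rewrite /= xS.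
Qed.

Lemma eq_expect bs (F G : seq T -> R) :
  (forall a, inbox bs a -> F a = G a) -> expect bs F = expect bs G.
Proof.
by move=> FG; apply/eqP; rewrite eq_le !le_expect // => a /FG ->.
Qed.

Lemma expectD bs (F G : seq T -> R) :
  expect bs (fun a => F a + G a) = expect bs F + expect bs G.
Proof.
elim: bs F G => [|S bs IH] F G //=; rewrite -IH.
by apply: eq_expect => a _; apply: avgD.
Qed.

Lemma expectZ bs c (F : seq T -> R) :
  expect bs (fun a => c * F a) = c * expect bs F.
Proof.
elim: bs F => [|S bs IH] F //=; rewrite -IH.
by apply: eq_expect => a _; apply: avgZ.
Qed.

Lemma expect_cst bs (c : R) : {in bs, forall S, 0 < size S}%N -> expect bs (fun=> c) = c.
Proof.
elim: bs => [|S bs IH] //= bs0; rewrite -[RHS]IH; last first.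
  by move=> S' bsS'; apply: bs0; rewrite inE bsS' orbT.
by apply: eq_expect => a _; rewrite avg_cst // bs0 ?mem_head.
Qed.

Fixpoint boxpoints bs : seq (seq T) :=
  if bs is s :: bs' then [seq x :: a | a <- boxpoints bs', x <- s] else [:: [::]].

Lemma mem_boxpoints bs a : (a \in boxpoints bs) = inbox bs a.
Proof.
elim: bs a => [|S bs IH] a /=; first by rewrite inE; case: a.
apply/allpairsP/idP => [[[a' x] /= [a'b xS ->]]|] /=.
  by rewrite xS -IH.
by case: a => // x a /= /andP[xS]; rewrite -IH => ab; exists (a, x).
Qed.

Lemma uniq_boxpoints bs : {in bs, forall S, uniq S} -> uniq (boxpoints bs).
Proof.
elim: bs => [|S bs IH] //= bsU; apply: allpairs_uniq; rewrite ?bsU ?mem_head //.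
  by apply: IH => S' bsS'; apply: bsU; rewrite inE bsS' orbT.
by move=> [a x] [a' x'] _ _ [-> ->].
Qed.

Lemma expectE bs (F : seq T -> R) :
  expect bs F = (\sum_(a <- boxpoints bs) F a) / (size (boxpoints bs))%:R.
Proof.
elim: bs F => [|S bs IH] F /=; first by rewrite big_seq1 divr1.
rewrite IH size_allpairs big_allpairs_dep /= natrM invfM mulrA mulrAC; congr (_ / _).
by rewrite mulr_suml.
Qed.

Lemma expect_count bs (P : pred (seq T)) : expect bs (fun a => (P a)%:R : R) =
  (count P (boxpoints bs))%:R / (size (boxpoints bs))%:R.
Proof. by rewrite expectE natr_count. Qed.

End AvgTheory.

(** * Ekedahl's sieve *)

Section Sieve.
Variables (R : realType) (A : idomainType) (nrm : A -> nat).
Hypothesis CN : counting_norm nrm.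
Implicit Types (p q : {classic nzprime A}) (s : seq {classic nzprime A}) (S : seq A).

Local Notation nm p := (prime_norm (p : nzprime A)).
Local Notation w p := ((nm p)%:R^-1 : R).

Lemma prime_norm_gt1 p : (1 < nm p)%N.
Proof. by rewrite (prime_normE CN) nrm_gen_gt1. Qed.

Lemma prime_weight_ge0 p : 0 <= w p.
Proof. by rewrite invr_ge0. Qed.

(** The error 1 is uniform in [m], so it also covers moduli whose norm exceeds the length of the
    side; the bound on norms lets that length control values of polynomials. *)
Definition good_box (S : seq A) : Prop :=
  [/\ uniq S, {in S, forall x, nrm x <= size S}%N &
      forall m r, m != 0 ->
        `|(count (fun x => `[<dvr m (x - r)>]) S)%:R - (size S)%:R / (nrm m)%:R| <= 1 :> R].

(** A nonzero polynomial over the field A/p has few roots; the argument is run on lifts. If [phi]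
    vanishes modulo [p] at [a], then phi - phi(a) = (X - a) psi with [psi] nonzero modulo [p] and of
    smaller size. *)
Lemma roots_mod p (phi : {poly A}) : (exists i, ~~ in_prime p phi`_i) ->
  exists2 rs, (size rs <= size phi)%N &
    forall x, in_prime p phi.[x] -> has (fun r => in_prime p (x - r)) rs.
Proof.
elim: {phi}(size phi) {-2}phi (leqnn (size phi)) => [|n IH] phi.
  by rewrite leqn0 size_poly_eq0 => /eqP-> [i]; rewrite coef0 in_prime0.
move=> phin [i phii].
have [[a pa]|noroot] := pselect (exists a, in_prime p phi.[a]); last first.
  by exists [::] => // x px; case: noroot; exists x.
have /factor_theorem[psi psiE] : root (phi - phi.[a]%:P) a.
  by rewrite rootE !hornerE subrr.
have npsi : exists j, ~~ in_prime p psi`_j.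
  apply/not_existsP => npsi; move/negP: phii; apply.
  have -> : phi = psi * 'X - psi * a%:P + phi.[a]%:P by rewrite -mulrBr -psiE subrK.
  have ppsi j : in_prime p psi`_j by apply/negPn/negP/npsi.
  rewrite coefD coefB coefMX coefMC coefC.
  apply: in_primeD; [apply: in_primeB|]; last by case: ifP; rewrite ?in_prime0.
    by case: ifP; rewrite ?in_prime0 ?ppsi.
  by rewrite in_primeM ppsi.
have psi0 : psi != 0.
  by have [j] := npsi; apply: contraNneq => ->; rewrite coef0 in_prime0.
have szpsi : (size psi < size phi)%N.
  have : (size (phi - phi.[a]%:P)%R <= maxn (size phi) (size (phi.[a]%:P)))%N.
    by rewrite (leq_trans (size_polyD _ _)) // size_polyN.
  rewrite psiE size_Mmonic ?monicXsubC // size_XsubC addn2 /= size_polyC.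
  rewrite leq_max => /orP[//|]; case: (_ != 0) => //=.
  by rewrite ltnS leqn0 size_poly_eq0 (negbTE psi0).
have [|rs srs rsP] := IH psi _ npsi; first by rewrite -ltnS (leq_trans szpsi).
exists (a :: rs) => [|x px /=]; first exact: leq_ltn_trans srs szpsi.
have : in_prime p (phi - phi.[a]%:P).[x] by rewrite !hornerE in_primeB.
by rewrite psiE !hornerE in_primeM orbC => /orP[->|/rsP ->]; rewrite ?orbT.
Qed.

Lemma avg_residue p r S : good_box S -> (0 < size S)%N ->
  avg S (fun x => (in_prime p (x - r))%:R) <= w p + (size S)%:R^-1 :> R.
Proof.
move=> [_ _ /(_ (gen CN p) r (gen_neq0 CN p))]; rewrite -(prime_normE CN) => cS S0.
rewrite avg_count (eq_count (a2 := fun x => `[<dvr (gen CN p) (x - r)>])); last first.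
  by move=> x; apply/idP/asboolP => /(in_primeP CN).
have N0 : 0 < (size S)%:R :> R by rewrite ltr0n.
rewrite ler_pdivrMr // mulrDl mulVf ?gt_eqF //.
by move: cS; rewrite ler_norml => /andP[_]; rewrite lerBlDr addrC mulrC.
Qed.

Lemma avg_roots p (phi : {poly A}) S : good_box S -> (0 < size S)%N ->
  (exists i, ~~ in_prime p phi`_i) ->
  avg S (fun x => (in_prime p phi.[x])%:R) <= (size phi)%:R * (w p + (size S)%:R^-1) :> R.
Proof.
move=> SG S0 /roots_mod[rs srs rsP].
have c0 : 0 <= w p + (size S)%:R^-1 :> R by rewrite addr_ge0 ?invr_ge0.
apply: (@le_trans _ _ ((size rs)%:R * (w p + (size S)%:R^-1))); last first.
  by rewrite ler_wpM2r // ler_nat.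
apply: (@le_trans _ _ (avg S (fun x => \sum_(r <- rs) (in_prime p (x - r))%:R))).
  apply: le_avg => x _; rewrite natr_count; case: (boolP (in_prime p phi.[x])) => // /rsP.
  by rewrite has_count ler_nat.
rewrite avg_sum -(sum1_size rs) natr_sum mulr_suml.
by apply: ler_sum => r _; rewrite mul1r; apply: avg_residue.
Qed.

Lemma dvr_prod_gen s x : uniq s -> {in s, forall p, in_prime p x} ->
  dvr (\prod_(p <- s) gen CN p) x.
Proof.
elim: s x => [|p s IH] x /=; first by rewrite big_nil => _ _; exists x; rewrite mulr1.
move=> /andP[ps us] sx.
have /(in_primeP CN)[y xE] : in_prime p x by apply: sx; rewrite mem_head.
have [|c yE] := IH y us.
  move=> q qs; have : in_prime q x by apply: sx; rewrite inE qs orbT.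
  rewrite xE in_primeM gen_notin ?orbF //.
  by apply: contraNneq ps => ->.
by exists c; rewrite xE yE big_cons -mulrA (mulrC (gen CN p)).
Qed.

(** The product of the distinct generators divides [x]. With N = 2 this gives finiteness of the
    prime divisors; with N the length of a side, a bound on the number of large ones. *)
Lemma prime_divisors_pow N s x : uniq s -> x != 0 ->
  {in s, forall p, in_prime p x /\ N <= nm p}%N -> (N ^ size s <= nrm x)%N.
Proof.
move=> us x0 sP; apply: leq_trans (nrm_dvr CN x0 (dvr_prod_gen us _)); last first.
  by move=> p /sP[].
rewrite (big_morph nrm (nrmM CN) (nrm_unit CN (unitr1 _))).
elim: s sP {us} => [|p s IH] sP; first by rewrite big_nil.
rewrite big_cons expnS leq_mul //.
  by rewrite -(prime_normE CN); have [] := sP p (mem_head _ _).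
by apply: IH => q qs; apply: sP; rewrite inE qs orbT.
Qed.

Lemma finite_prime_divisors x : x != 0 ->
  exists s, forall p, in_prime p x -> p \in s.
Proof.
move=> x0; apply: contrapT => /forallNP nex.
suff /(_ (nrm x))[s [us sx sn]] : forall n, exists s,
    [/\ uniq s, {in s, forall p, in_prime p x} & size s = n].
  suff : (2 ^ size s <= nrm x)%N by rewrite sn leqNgt ltn_expl.
  by apply: prime_divisors_pow => // p ps; split; [apply: sx | apply: prime_norm_gt1].
elim=> [|n [s [us sx sn]]]; first by exists [::].
have /existsNP[p /not_implyP[px ps]] := nex s.
exists (p :: s); split => /=; rewrite ?sn //; first by rewrite us andbT; apply/negP.
by move=> q; rewrite inE => /predU1P[->|/sx].
Qed.

Lemma nrm_ev_bound k (h : ipoly A k) : exists D N0, forall N a, (N0 <= N)%N ->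
  size a = k -> {in a, forall x, nrm x <= N}%N -> (nrm (ev a h) <= N ^ D)%N.
Proof.
suff [C [D CD]] : exists C D, forall N a, (0 < N)%N ->
    size a = k -> {in a, forall x, nrm x <= N}%N -> (nrm (ev a h) <= C * N ^ D)%N.
  (* Once N exceeds [C], one more power of N absorbs the constant. *)
  exists D.+1, C.+1 => N a CN' sa aN; rewrite expnS.
  by rewrite (leq_trans (CD _ _ (leq_ltn_trans _ CN') sa aN)) // leq_mul2r (ltnW CN') orbT.
elim: k h => [|k IH] h; first by exists (nrm h), 0%N => N a _ _ _ /=; rewrite muln1.
elim/poly_ind: (h : {poly ipoly A k}) => [|g c [C [D CD]]].
  by exists 0%N, 0%N => N a *; rewrite rmorph0 (nrm0 CN).
have [C' [D' CD']] := IH c; exists (C + C')%N, (D.+1 + D')%N => N [//|x a] N0 [sa] aN.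
rewrite rmorphD rmorphM gevC gevX [head _ _]/= [behead _]/= mulnDl.
apply: (leq_trans (nrmD CN _ _)); apply: leq_add; rewrite ?(nrmM CN).
  apply: (@leq_trans ((C * N ^ D) * N)).
    by apply: leq_mul; [apply: CD => //=; rewrite sa | apply: aN; rewrite mem_head].
  by rewrite -mulnA -expnSr leq_mul2l leq_pexp2l ?orbT // leq_addr.
apply: leq_trans (CD' N a N0 sa _) _; first by move=> y ya; apply: aN; rewrite inE ya orbT.
by rewrite leq_mul2l leq_pexp2l ?orbT // leq_addl.
Qed.

Lemma seq_max_norm s : s != [::] -> exists2 p, p \in s & {in s, forall q, nm q <= nm p}%N.
Proof.
elim: s => // p [|p' s] IH _; first by exists p; rewrite ?mem_head // => q; rewrite inE => /eqP->.
have [//|q qs qmax] := IH; have [pq|qp] := leqP (nm p) (nm q).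
  by exists q => [|r]; rewrite in_cons ?qs ?orbT // => /predU1P[->|/qmax].
exists p; rewrite ?mem_head // => r; rewrite in_cons => /predU1P[->//|/qmax rq].
exact: leq_trans rq (ltnW qp).
Qed.

(* The j-th smallest norm of a prime is at least j / C. *)
Lemma sum_inv_sq_bound : exists B : R, forall s, uniq s -> \sum_(p <- s) w p ^+ 2 <= B.
Proof.
have [C C0 CP] := nrm_count CN; exists (C%:R ^+ 2 * 2) => s us.
(* The subtracted term makes the sum telescope: 1/(n+1)^2 <= 2/(n+1) - 2/(n+2). *)
suff H n : size s = n -> \sum_(p <- s) w p ^+ 2 <= C%:R ^+ 2 * (2 - 2 / n.+1%:R).
  apply: le_trans (H _ erefl) _.
  by rewrite ler_wpM2l ?exprn_ge0 // gerBl divr_ge0.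
elim: n s us => [|n IH] s us sn.
  by rewrite (size0nil sn) big_nil divr1 subrr mulr0.
have [|p ps pmax] := @seq_max_norm s; first by case: s sn {us}.
have sC : (n.+1 <= C * nm p)%N.
  rewrite -sn -(@size_map {classic nzprime A} A (gen CN)); apply: CP.
  - exact: ltnW (prime_norm_gt1 p).
  - by rewrite (map_inj_uniq (@gen_inj _ _ CN)).
  - by move=> x /mapP[q qs ->]; rewrite -(prime_normE CN) pmax.
rewrite (perm_big _ (perm_to_rem ps)) big_cons /=.
have sr : size (rem p s) = n by rewrite size_rem // sn.
apply: le_trans (lerD (lexx _) (IH _ (rem_uniq _ us) sr)) _.
have p0 : 0 < (nm p)%:R :> R by rewrite ltr0n (ltnW (prime_norm_gt1 p)).
have n0 : 0 < n.+1%:R :> R by rewrite ltr0n.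
apply: (@le_trans _ _ (C%:R ^+ 2 * n.+1%:R^-1 ^+ 2 + C%:R ^+ 2 * (2 - 2 / n.+1%:R))).
  rewrite lerD2r -exprMn lerXn2r ?nnegrE ?prime_weight_ge0 ?mulr_ge0 ?invr_ge0 //.
  by rewrite ler_pdivlMr // mulrC ler_pdivrMr // -natrM ler_nat.
rewrite -mulrDr ler_wpM2l ?exprn_ge0 //.
have -> : n.+2%:R = n.+1%:R + 1 :> R by rewrite -natr1.
have x1 : 1 <= n.+1%:R :> R by rewrite ler1n.
move: (n.+1%:R : R) n0 x1 => x x0 x1.
have y0 : 0 < x + 1 by rewrite addr_gt0.
have -> : x^-1 ^+ 2 + (2 - 2 / x) = 2 - (2 * x - 1) / x ^+ 2.
  rewrite mulrBl mul1r opprB addrCA addrC -exprVn expr2 mulrA.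
  by rewrite mulfK ?gt_eqF // addrC.
rewrite lerD2l lerN2 ler_pdivrMr // mulrAC ler_pdivlMr ?exprn_gt0 //.
nra.
Qed.

End Sieve.

(* The points failing this have density 0 and are discarded; at the others, none
   of the polynomials met in the induction on leading coefficients vanishes. *)
Fixpoint nonvan (A : idomainType) (k : nat) : ipoly A k -> seq A -> bool :=
  match k with
  | 0 => fun h _ => h != 0
  | k'.+1 => fun h a =>
      nonvan (lead_coef (h : {poly ipoly A k'})) (behead a) && (gev idfun k'.+1 a h != 0)
  end.

Lemma nonvan_neq0 (A : idomainType) k (h : ipoly A k) a : nonvan h a -> ev a h != 0.
Proof. by case: k h => [|k] h //= /andP[]. Qed.

Lemma exists_small (R : realType) (C e : R) : 0 <= C -> 0 < e -> exists2 d, 0 < d & C * d <= e.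
Proof.
move=> C0 e0; exists (e / (C + 1)); first by rewrite divr_gt0 // ltr_wpDl.
rewrite mulrCA ler_piMr ?(ltW e0) // ler_pdivrMr ?ltr_wpDl // mul1r.
by rewrite lerDl.
Qed.

Lemma exists_large (R : realType) (C e : R) : 0 <= C -> 0 < e ->
  exists2 N0, (0 < N0)%N & forall N, (N0 <= N)%N -> C / N%:R <= e.
Proof.
move=> C0 e0; exists (Num.bound (C / e)).+1 => // N NN.
have N0 : 0 < N%:R :> R by rewrite ltr0n (leq_trans _ NN).
rewrite ler_pdivrMr // mulrC -ler_pdivrMr //.
have /ltW/le_trans := archi_boundP (divr_ge0 C0 (ltW e0)); apply.
by rewrite ler_nat ltnW.
Qed.

(** * The average of the sum of 1/|p| over the primes dividing a value *)

Section Ekedahl.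
Variables (R : realType) (A : idomainType) (nrm : A -> nat).
Hypothesis CN : counting_norm nrm.
Implicit Types (p q : {classic nzprime A}) (s : seq {classic nzprime A}) (S : seq A).

Local Notation nm p := (prime_norm (p : nzprime A)).
Local Notation w p := ((nm p)%:R^-1 : R).
Local Notation good_box := (good_box R nrm).

(** Otherwise one could keep adding disjoint finite sets of primes, each of mass above [e], and
    exceed the bound of [sum_inv_sq_bound]. *)
Lemma prime_sq_tail (e : R) : 0 < e -> exists T : seq {classic nzprime A},
  forall s, uniq s -> {in s, forall p, p \notin T} -> \sum_(p <- s) w p ^+ 2 <= e.
Proof.
move=> e0; apply: contrapT => /forallNP nex.
have [B BP] := sum_inv_sq_bound R CN.
have H n : exists s, uniq s /\ e *+ n <= \sum_(p <- s) w p ^+ 2.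
  elim: n => [|n [s [us sn]]]; first by exists [::]; rewrite big_nil.
  have /existsNP[t /not_implyP[ut /not_implyP[ts /negP]]] := nex s.
  rewrite -ltNge => tn; exists (s ++ t); split.
    rewrite cat_uniq us ut andbT /=; apply/hasPn => p pt; exact: ts.
  by rewrite big_cat mulrS addrC lerD // ltW.
have B0 : 0 <= B by have := BP [::] isT; rewrite big_nil.
have [N N0 /(_ N (leqnn _))] := exists_large (addr_ge0 B0 ler01) e0.
have [s [us /le_trans/(_ (BP s us))]] := H N.
rewrite -[e *+ N]mulr_natr ler_pdivrMr ?ltr0n // => H1 /le_trans/(_ H1).
by rewrite gerDl ler10.
Qed.

(* Sides decrease, so that the outermost variable of [ipoly] has the longest one. *)
Fixpoint nested (N : nat) (bs : seq (seq A)) : Prop :=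
  if bs is s :: bs' then
    [/\ good_box s, (N <= size s)%N, {in bs', forall t, size t <= size s}%N & nested N bs']
  else True.

Lemma nested_gt0 N bs : (0 < N)%N -> nested N bs -> {in bs, forall S, 0 < size S}%N.
Proof.
move=> N0; elim: bs => [|S bs IH] //= [_ NS _ /IH nb] S'.
by rewrite inE => /predU1P[->|/nb//]; apply: leq_trans NS.
Qed.

Lemma nested_le N N' bs : (N' <= N)%N -> nested N bs -> nested N' bs.
Proof.
move=> NN; elim: bs => [|S bs IH] //= [? NS ? /IH]; split=> //.
exact: leq_trans NS.
Qed.

Lemma inbox_nrm S N bs a : nested N (S :: bs) -> inbox bs a ->
  {in a, forall x, nrm x <= size S}%N.
Proof.
move=> [_ _ le nb]; elim: bs a le nb => [|S' bs IH] [|y a] //= le [[_ S'n _] _ _ nb].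
move=> /andP[yS' ab] x; rewrite inE => /predU1P[->|xa].
  by apply: leq_trans (S'n y yS') _; apply: le; rewrite mem_head.
by apply: IH nb ab _ xa => t tb; apply: le; rewrite inE tb orbT.
Qed.

(** Where the leading coefficient does not vanish, h(., a) is a nonzero polynomial in one variable,
    with fewer than [size h] roots among at least N points. The sizes add up along the chain of
    leading coefficients. *)
Lemma expect_nonvan k (h : ipoly A k) : h != 0 -> exists2 C, 0 <= C &
  forall N bs, (0 < N)%N -> nested N bs -> size bs = k ->
    expect bs (fun a => (~~ nonvan h a)%:R) <= C / N%:R :> R.
Proof.
elim: k h => [|k IH] h h0.
  by exists 0 => // N [|//] N0 _ _ /=; rewrite h0 mul0r.
have [|C C0 CP] := IH (lead_coef (h : {poly ipoly A k})); first by rewrite lead_coef_eq0.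
exists (C + (size (h : {poly _}))%:R) => [|N [|S bs] N0 //= [SG NS _ nb] [sb]].
  exact: addr_ge0.
have S0 : (0 < size S)%N by apply: leq_trans NS.
rewrite mulrDl; set c := _%:R / N%:R.
have c0 : 0 <= c by rewrite divr_ge0.
apply: le_trans (lerD (CP N bs N0 nb sb) (lexx c)).
rewrite -[in leRHS](@expect_cst R A bs c (nested_gt0 N0 nb)) -expectD.
apply: le_expect => a ab; case: (boolP (nonvan _ a)) => nv /=; last first.
  by rewrite avg_cst ?lerDl.
rewrite mulr0n add0r.
have /nonvan_neq0 := nv; set phi := map_poly (gev idfun k a) h => lc0.
have phi0 : phi != 0.
  apply: contraNneq lc0 => phi0.
  by rewrite -[_ (lead_coef _)]coef_map -/phi phi0 coef0.
have -> : avg S (fun x => (~~ (horner_eval x phi != 0))%:R) =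
    (count (root phi) S)%:R / (size S)%:R :> R.
  by rewrite -avg_count; apply: eq_avg => x _; rewrite negbK.
rewrite ler_pM ?invr_ge0 // ?ler_nat ?lef_pV2 ?posrE ?ltr0n ?ler_nat //.
have [uS _ _] := SG; rewrite -size_filter; apply: ltnW.
have szphi : (size phi <= size (h : {poly _}))%N by apply: size_poly.
apply: leq_trans szphi; apply: max_poly_roots => //; last exact: filter_uniq.
by apply/allP => x; rewrite mem_filter => /andP[].
Qed.

(** A nonzero value of norm at most N^D cannot have more than D distinct prime divisors of norm
    above N. *)
Lemma few_large_primes k (h : ipoly A k) : exists D N0, forall N a s,
  (N0 <= N)%N -> size a = k -> {in a, forall x, nrm x <= N}%N ->
  uniq s -> ev a h != 0 ->
  (count (fun p => (N < nm p)%N && in_prime p (ev a h)) s <= D)%N.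
Proof.
(* N >= 2 allows exponents of N to be compared. *)
have [D [N0 DP]] := nrm_ev_bound CN h; exists D, (maxn N0 2) => N a s.
rewrite geq_max => /andP[NN N2] sa aN us ha0.
pose s' := [seq p <- s | (N < nm p)%N && in_prime p (ev a h)].
rewrite -size_filter -/s' -(leq_exp2l (m := N)) //.
apply: leq_trans (DP N a NN sa aN).
apply: (prime_divisors_pow CN) => //; first exact: filter_uniq.
by move=> p; rewrite mem_filter => /andP[/andP[/ltnW ? ?] _].
Qed.

Definition weight s (x : A) : R := \sum_(p <- s | in_prime p x) w p.

Lemma weight_ge0 s x : 0 <= weight s x.
Proof. by apply: sumr_ge0 => p _; apply: prime_weight_ge0. Qed.

(* Primes above [size S] are few; those below divide the leading coefficient of
   [h] at [a] or leave at most [size h] residues for the outermost coordinate. *)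
Lemma weight_step k (h : ipoly A k.+1) : exists2 D, 0 <= D & exists2 N0, (0 < N0)%N &
  forall S bs a s, nested N0 (S :: bs) -> size bs = k -> inbox bs a -> uniq s ->
  avg S (fun x => (nonvan h (x :: a))%:R * weight s (ev (x :: a) h)) <=
  (nonvan (lead_coef (h : {poly ipoly A k})) a)%:R *
    weight s (ev a (lead_coef (h : {poly ipoly A k}))) +
  (D * \sum_(p <- s) w p ^+ 2 + D / (size S)%:R) :> R.
Proof.
have [D [N0 DP]] := few_large_primes h.
set c := lead_coef _; pose d := size (h : {poly ipoly A k}).
exists ((d * 2)%:R + D%:R); first by rewrite addr_ge0.
exists N0.+1 => // S bs a s nSb sb ab us; have [SG NS le nb] := nSb; set N := size S.
have N00 : (0 < N0.+1)%N by [].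
have N0R : 0 < N%:R :> R by rewrite ltr0n (leq_trans N00).
have sq0 : 0 <= \sum_(p <- s) w p ^+ 2.
  by apply: sumr_ge0 => p _; rewrite exprn_ge0 ?prime_weight_ge0.
have rest0 : 0 <= ((d * 2)%:R + D%:R) * \sum_(p <- s) w p ^+ 2 + ((d * 2)%:R + D%:R) / N%:R.
  by rewrite addr_ge0 ?mulr_ge0 ?invr_ge0 ?addr_ge0.
have [nv|nv] := boolP (nonvan c a); last first.
  rewrite mul0r add0r; apply: le_trans rest0.
  rewrite -[leRHS](avg_cst (0 : R) (leq_trans N00 NS)); apply: le_avg => x _.
  by rewrite [nonvan _ _]/= (negbTE nv) mul0r.
rewrite mul1r; set phi := map_poly (gev idfun k a) h.
have szphi : (size phi <= d)%N by apply: size_poly.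
have phiE x : ev (x :: a) h = phi.[x] by [].
have c_coef : ev a c = phi`_d.-1 by rewrite coef_map.
pose small p := (nm p <= N)%N && ~~ in_prime p (ev a c).
(* A prime dividing h(x, a) divides the leading coefficient [c] at [a], or is [small], or has norm
   above N. Those of the last kind are at most D, each of weight at most 1/N. *)
apply: (@le_trans _ _ (avg S (fun x => (weight s (ev a c) + D%:R / N%:R) +
    \sum_(p <- s | small p) w p * (in_prime p phi.[x])%:R))).
  apply: le_avg => x xS.
  have S0 : 0 <= \sum_(p <- s | small p) w p * (in_prime p phi.[x])%:R.
    by apply: sumr_ge0 => p _; rewrite mulr_ge0 ?prime_weight_ge0.
  have [h0|h0] := eqVneq (ev (x :: a) h) 0.
    rewrite [nonvan _ _]/= -[_.[_]]/(ev (x :: a) h) [X in X != 0]h0 eqxx andbF mul0r.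
    by rewrite !addr_ge0 ?weight_ge0 // divr_ge0 // ltW.
  apply: (@le_trans _ _ (weight s (ev (x :: a) h))).
    by rewrite ler_piMl ?weight_ge0 // lern1 leq_b1.
  rewrite addrAC; apply: (@le_trans _ _ (weight s (ev a c) +
      \sum_(p <- s | small p) w p * (in_prime p phi.[x])%:R +
      \sum_(p <- s | (N < nm p)%N && in_prime p phi.[x]) w p)).
    rewrite /weight big_mkcond [X in _ <= X + _ + _]big_mkcond.
    rewrite [X in _ <= _ + X + _]big_mkcond [X in _ <= _ + _ + X]big_mkcond.
    rewrite -!big_split; apply: ler_sum => p _; rewrite phiE /small /=.
    have w0 := prime_weight_ge0 R p.
    by case: (in_prime p (ev a c)); case: (in_prime p phi.[x]); case: ltnP => _ /=;
      rewrite ?mulr0 ?mulr1 ?addr0 ?add0r ?addr_ge0 ?lerDl.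
  rewrite lerD2l; apply: (@le_trans _ _
      (\sum_(p <- s | (N < nm p)%N && in_prime p phi.[x]) N%:R^-1)).
    apply: ler_sum => p /andP[Np _]; rewrite lef_pV2 ?posrE // ?ltr0n ?(ltn_trans _ Np) //.
      by rewrite ler_nat ltnW.
    by rewrite -(ltr0n R).
  rewrite big_const_seq iter_addr_0 -[_ *+ _]mulr_natl ler_pM2r ?invr_gt0 // ler_nat.
  apply: (DP N (x :: a) s) => //=; rewrite ?(size_inbox ab) ?sb ?(ltnW NS) //.
  move=> y; rewrite inE => /predU1P[->|ya]; first by case: SG => _ /(_ x xS).
  exact: inbox_nrm nSb ab y ya.
rewrite avgD avg_cst ?(leq_trans N00) // -addrA lerD2l mulrDl mulrDl addrC.
rewrite avg_sum; apply: (@le_trans _ _ ((d * 2)%:R * \sum_(p <- s) w p ^+ 2 + D%:R / N%:R)).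
  rewrite lerD2r mulr_sumr big_mkcond; apply: ler_sum => p _.
  have w0 := prime_weight_ge0 R p.
  case: ifP => [/andP[pN pc]|_]; last by rewrite mulr_ge0 // exprn_ge0.
  rewrite avgZ.
  (* For a small prime the root bound d(1/|p| + 1/N) is at most 2d/|p|, whence the factor [d * 2];
     multiplied by the weight 1/|p| it gives a summable term. *)
  have wN : N%:R^-1 <= w p.
    by rewrite lef_pV2 ?posrE ?ler_nat // ltr0n ltnW // (prime_norm_gt1 CN).
  apply: (@le_trans _ _ (w p * ((size phi)%:R * (w p + N%:R^-1)))).
    rewrite ler_wpM2l //; apply: (avg_roots CN SG (leq_trans N00 NS)).
    by exists d.-1; rewrite -c_coef.
  rewrite expr2 [leRHS]mulrCA ler_wpM2l //.
  have -> : (d * 2)%:R * w p = d%:R * (w p + w p) by rewrite natrM; lra.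
  by apply: ler_pM; rewrite ?addr_ge0 ?invr_ge0 ?ler_nat ?lerD2l.
have : 0 <= D%:R * \sum_(p <- s) w p ^+ 2 by rewrite mulr_ge0.
have : 0 <= (d * 2)%:R / N%:R :> R by rewrite divr_ge0.
lra.
Qed.

(** In zero variables [h] is a nonzero constant and [T] contains all its prime divisors. At each
    further variable, e/3 goes to the leading coefficient, e/3 to the tail of the sum of 1/|p|^2,
    and e/3 to the term D/N. *)
Lemma weight_small k (h : ipoly A k) (e : R) : h != 0 -> 0 < e ->
  exists (T : seq {classic nzprime A}) N0, forall bs s, nested N0 bs -> size bs = k ->
    uniq s -> {in s, forall p, p \notin T} ->
    expect bs (fun a => (nonvan h a)%:R * weight s (ev a h)) <= e.
Proof.
elim: k h e => [|k IH] h e h0 e0.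
  have [T TP] := finite_prime_divisors CN h0; exists T, 0%N => -[|//] s _ _ us sT /=.
  rewrite /weight big1_seq ?mulr0 ?ltW // => p /andP[ph ps].
  by have := sT p ps; rewrite TP.
have [D D0 [N1 _ DP]] := weight_step h.
have e3 : 0 < e / 3 by rewrite divr_gt0.
have [|T2 [N2 T2P]] := IH (lead_coef (h : {poly ipoly A k})) (e / 3) _ e3.
  by rewrite lead_coef_eq0.
have [d d0 dD] := exists_small D0 e3; have [T3 T3P] := prime_sq_tail d0.
have [N3 N30 N3P] := exists_large D0 e3.
pose N0 := maxn (maxn N1 N2) N3.
exists (T2 ++ T3), N0 => -[//|S bs] s nSb [sb] us sT.
have N00 : (0 < N0)%N by rewrite (leq_trans N30) // leq_maxr.
have [SG NS le nb] := nSb.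
rewrite [expect _ _]/=.
have tail : D * (\sum_(p <- s) w p ^+ 2) + D / (size S)%:R <= e / 3 + e / 3.
  apply: lerD; last by apply: N3P; rewrite (leq_trans _ NS) // leq_maxr.
  apply: le_trans dD; rewrite ler_wpM2l // T3P // => p /sT.
  by rewrite mem_cat negb_or => /andP[].
apply: (@le_trans _ _ (expect bs (fun a =>
  (nonvan (lead_coef (h : {poly ipoly A k})) a)%:R *
    weight s (ev a (lead_coef (h : {poly ipoly A k}))) + (e / 3 + e / 3)))).
  apply: le_expect => a ab.
  apply: le_trans (lerD (lexx _) tail).
  by apply: (DP S bs a s) => //; apply: (nested_le _ nSb); rewrite /N0 -maxnA leq_maxl.
rewrite expectD (expect_cst _ (nested_gt0 N00 nb)).
rewrite [leRHS](_ : e = e / 3 + (e / 3 + e / 3)); last by lra.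
rewrite lerD2r; apply: T2P => //.
  by apply: (nested_le _ nb); rewrite /N0 -maxnA maxnCA leq_maxl.
by move=> p /sT; rewrite mem_cat negb_or => /andP[].
Qed.

End Ekedahl.

Lemma leq_sum5 (a b c d e : nat) (t := (a + b + c + d + e)%N) :
  [/\ a <= t, b <= t, c <= t, d <= t & e <= t]%N.
Proof. by rewrite /t; split; lia. Qed.

(** * Primes dividing all values of a coprime family *)

Section CommonPrimes.
Variables (R : realType) (A : idomainType) (nrm : A -> nat).
Hypothesis CN : counting_norm nrm.
Implicit Types (p q : {classic nzprime A}) (s : seq {classic nzprime A}) (S : seq A).

Local Notation nm p := (prime_norm (p : nzprime A)).
Local Notation w p := ((nm p)%:R^-1 : R).
Local Notation good_box := (good_box R nrm).
Local Notation nested := (nested R nrm).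

Definition common_prime k (L : seq (ipoly A k)) (a : seq A) p : bool :=
  all (fun l => in_prime p (ev a l)) L.

Definition coefs k (L : seq (ipoly A k.+1)) : seq (ipoly A k) :=
  flatten [seq (l : {poly ipoly A k}) : seq (ipoly A k) | l <- L].

Lemma mem_coefs k (L : seq (ipoly A k.+1)) c : c \in coefs L ->
  exists (l : {poly ipoly A k}) i, l \in L /\ c = l`_i.
Proof.
by move=> /flatten_mapP[l lL /(nthP 0)[i _ <-]]; exists l, i.
Qed.

Lemma icst_inj k : injective (icst A k).
Proof.
by move=> c d /(congr1 (gev idfun k [::])); rewrite !gev_cst.
Qed.

Lemma factorial_ipoly k : factorial_ring (ipoly A k).
Proof. by elim: k => [|k IH]; [apply: factorial_nrm CN | apply: factorial_poly]. Qed.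

(** Nonzero constants are allowed as common divisors, because coprimality over the fraction field of
    [A] cannot see them. The condition is inherited by the coefficients, and in zero variables it
    says that some member is nonzero. *)
Definition coprime_family k (L : seq (ipoly A k)) : Prop :=
  forall d, {in L, forall l, dvr d l} -> exists2 c, c != 0 & d = icst A k c.

Lemma coprime_coefs k (L : seq (ipoly A k.+1)) : coprime_family L -> coprime_family (coefs L).
Proof.
move=> cop d dL; have [|c c0 /polyC_inj dE] := cop (d%:P : {poly ipoly A k}); last by exists c.
move=> l lL; apply/(dvr_polyC d (l : {poly ipoly A k})) => i.
have [il|il] := ltnP i (size (l : {poly ipoly A k})).
  by apply: dL; apply/flatten_mapP; exists l => //; apply: mem_nth.
by rewrite nth_default //; apply: dvr0.
Qed.

Lemma common_prime_step k (L : seq (ipoly A k.+1)) : coprime_family L ->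
  exists2 h : ipoly A k, h != 0 & exists2 D : R, 0 <= D & exists2 N0, (0 < N0)%N &
  forall S bs a s, nested N0 (S :: bs) -> size bs = k -> inbox bs a -> uniq s ->
  avg S (fun x => (has (common_prime L (x :: a)) s)%:R) <=
  (~~ nonvan h a)%:R + (has (common_prime (coefs L) a) s)%:R +
  (D * ((nonvan h a)%:R * weight R s (ev a h)) + D / (size S)%:R) :> R.
Proof.
move=> cop.
have [|h h0 hJ] := @const_in_ideal _ (L : seq {poly ipoly A k}) (@factorial_ipoly k).
  move=> d /cop[c c0 ->] /=; rewrite size_polyC.
  by rewrite -(rmorph0 (icst A k)) (inj_eq (@icst_inj k)) c0.
exists h => //.
have [D [N1 DP]] := few_large_primes CN h.
pose d := (\sum_(l <- (L : seq {poly ipoly A k})) size l)%N.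
(* Each prime dividing h(a) but not all coefficients costs d(1/|p| + 1/N). If |p| <= N this is at
   most 2d/|p|, charged to the weight; otherwise it is at most 2d/N, for at most D primes. *)
exists ((2 * d + D * (2 * d))%:R) => //; exists N1.+1 => // S bs a s nSb sb ab us.
have [SG NS _ _] := nSb; set N := size S.
have S0 : (0 < N)%N by apply: leq_ltn_trans NS.
have N0R : 0 < N%:R :> R by rewrite ltr0n.
have W0 := weight_ge0 R s (ev a h).
have C0 : 0 <= (2 * d + D * (2 * d))%:R / N%:R :> R by rewrite divr_ge0.
(* If [h] degenerates at [a], or if some prime of [s] divides all coefficients there, the trivial
   bound 1 is matched by an indicator on the right. *)
have [nv|nv] := boolP (nonvan h a); last first.
  rewrite mulr1n mul0r mulr0 add0r.
  apply: (@le_trans _ _ (1 + 0 + 0)); last by rewrite !lerD.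
  rewrite !addr0 -[leRHS](avg_cst (1 : R) S0); apply: le_avg => x _.
  by rewrite lern1 leq_b1.
rewrite mulr0n add0r mul1r.
have [hs|hs] := boolP (has _ s).
  apply: (@le_trans _ _ (1 + 0)); last by rewrite lerD ?addr_ge0 ?mulr_ge0.
  rewrite addr0 -[leRHS](avg_cst (1 : R) S0); apply: le_avg => x _.
  by rewrite lern1 leq_b1.
rewrite mulr0n add0r.
have h0a := nonvan_neq0 nv.
apply: (@le_trans _ _ (avg S (fun x =>
    \sum_(p <- s | in_prime p (ev a h)) (common_prime L (x :: a) p)%:R))).
  apply: le_avg => x _.
  have -> : \sum_(p <- s | in_prime p (ev a h)) (common_prime L (x :: a) p)%:R =
      (count (fun p => in_prime p (ev a h) && common_prime L (x :: a) p) s)%:R :> R.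
    by rewrite -natr_count big_mkcond; apply: eq_bigr => p _; case: (in_prime p _).
  case: (boolP (has _ s)) => // /hasP[p ps pL]; rewrite ler1n -has_count.
  apply/hasP; exists p => //; rewrite pL andbT.
  (* The polynomials whose value at this point lies in [p] form an ideal containing L, hence [h]. *)
  have := hJ (fun q : {poly ipoly A k} => in_prime p (gev idfun k.+1 (x :: a) q)).
  rewrite gevC; apply => [|l lL]; last exact: (allP pL).
  split=> [|q r|c q]; rewrite ?rmorph0 ?rmorphD ?rmorphM ?in_prime0 //.
    exact: in_primeD.
  by rewrite in_primeM => ->; rewrite orbT.
rewrite avg_sum.
apply: (@le_trans _ _ (\sum_(p <- s | in_prime p (ev a h)) (d%:R * (w p + N%:R^-1)))).
  rewrite big_seq_cond [leRHS]big_seq_cond; apply: ler_sum => p /andP[ps ph].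
  have : ~~ common_prime (coefs L) a p by apply: contraNN hs => ?; apply/hasP; exists p.
  move=> /allPn[c /mem_coefs[l [i [lL ->]]] nc].
  pose phi := map_poly (gev idfun k a) l.
  have szphi : (size phi <= d)%N.
    apply: leq_trans (size_poly _ _) _.
    by rewrite /d (big_rem (l : {poly ipoly A k})) //= leq_addr.
  apply: (@le_trans _ _ (avg S (fun x => (in_prime p phi.[x])%:R))).
    apply: le_avg => x _; case: (boolP (common_prime L _ p)) => // /allP/(_ l lL) pl.
    by have -> : in_prime p phi.[x] by exact: pl.
  apply: le_trans (avg_roots CN SG S0 _) _; first by exists i; rewrite coef_map.
  by rewrite ler_wpM2r ?ler_nat // addr_ge0 ?prime_weight_ge0 ?invr_ge0.
apply: (@le_trans _ _ (\sum_(p <- s | in_prime p (ev a h)) (2 * d)%:R * w p +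
    \sum_(p <- s | (N < nm p)%N && in_prime p (ev a h)) (2 * d)%:R / N%:R)).
  rewrite big_mkcond [X in _ <= X + _]big_mkcond [X in _ <= _ + X]big_mkcond -big_split.
  apply: ler_sum => p _ /=; case: (in_prime p _); rewrite ?andbF ?andbT ?addr0 //.
  have p0 : 0 < (nm p)%:R :> R by rewrite ltr0n ltnW // (prime_norm_gt1 CN).
  rewrite natrM; case: ltnP => [Np|pN].
    have : w p <= N%:R^-1 by rewrite lef_pV2 ?posrE // ler_nat ltnW.
    have := prime_weight_ge0 R p; have : 0 <= d%:R :> R by [].
    nra.
  have : N%:R^-1 <= w p by rewrite lef_pV2 ?posrE // ler_nat.
  have : 0 <= d%:R :> R by [].
  nra.
rewrite -mulr_sumr big_const_seq iter_addr_0 -[X in _ + X <= _]mulr_natl mulrA.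
apply: lerD; first by rewrite ler_wpM2r // ler_nat leq_addr.
rewrite ler_pM2r ?invr_gt0 // -natrM ler_nat.
apply: leq_trans (leq_addl _ _); rewrite leq_mul2r; apply/orP; right.
apply: DP => //; first exact: leq_trans (leqnSn _) NS.
- by rewrite (size_inbox ab).
- exact: inbox_nrm nSb ab.
Qed.

Lemma common_prime_small k (L : seq (ipoly A k)) (e : R) : coprime_family L -> 0 < e ->
  exists (T : seq {classic nzprime A}) N0, (0 < N0)%N /\ forall bs s, nested N0 bs -> size bs = k ->
    uniq s -> {in s, forall p, p \notin T} ->
    expect bs (fun a => (has (common_prime L a) s)%:R) <= e.
Proof.
elim: k L e => [|k IH] L e cop e0.
  (* In zero variables some constant of the family is nonzero, since otherwise 0 would be a common
     divisor; its prime divisors go into [T]. *)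
  have [l lL l0] : exists2 l, l \in L & l != 0.
    apply: contrapT => H; have [|c c0 /esym/eqP] := cop 0.
      move=> l lL; have [->|l0] := eqVneq l 0; first exact: dvr0.
      by case: H; exists l.
    by rewrite (negbTE c0).
  have [T TP] := finite_prime_divisors CN l0; exists T, 1%N; split=> // -[|//] s _ _ us sT /=.
  rewrite (_ : has _ _ = false) ?ltW //; apply/hasPn => p ps.
  by apply: contra (sT p ps) => /allP/(_ l lL)/TP.
have [h h0 [D D0 [N1 N10 HP]]] := common_prime_step cop.
(* Four error terms follow, each at most e/5: degenerate points, the coefficient family, the weight
   of h(a), and D/N. *)
have e5 : 0 < e / 5 by rewrite divr_gt0.
have [T2 [N2 [_ T2P]]] := IH _ _ (coprime_coefs cop) e5.
have [d d0 dD] := exists_small D0 e5.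
have [T3 [N3 T3P]] := weight_small CN h0 d0.
have [N4 N40 N4P] := exists_large D0 e5.
have [C C0 CP] := expect_nonvan R nrm h0.
have [N5 N50 N5P] := exists_large C0 e5.
pose N0 := (N1 + N2 + N3 + N4 + N5)%N.
have [le1 le2 le3 le4 le5] := leq_sum5 N1 N2 N3 N4 N5; rewrite -/N0 in le1 le2 le3 le4 le5.
have N00 : (0 < N0)%N by apply: leq_trans le1.
exists (T2 ++ T3), N0; split=> // -[//|S bs] s nSb [sb] us sT.
have [SG NS le nb] := nSb.
rewrite [expect _ _]/=.
have large : D / (size S)%:R <= e / 5 by apply: N4P; apply: leq_trans NS.
apply: (@le_trans _ _ (expect bs (fun a =>
  (~~ nonvan h a)%:R + (has (common_prime (coefs L) a) s)%:R +
  (D * ((nonvan h a)%:R * weight R s (ev a h)) + e / 5)))).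
  apply: le_expect => a ab.
  apply: le_trans (HP S bs a s _ sb ab us) _; last by rewrite !lerD2l.
  exact: (nested_le le1 nSb).
rewrite !expectD expectZ (expect_cst _ (nested_gt0 N00 nb)).
have i1 : expect bs (fun a => (~~ nonvan h a)%:R) <= e / 5 :> R.
  apply: le_trans (CP N0 bs N00 nb sb) _; exact: N5P.
have i2 : expect bs (fun a => (has (common_prime (coefs L) a) s)%:R) <= e / 5 :> R.
  apply: T2P => //; first exact: (nested_le le2 nb).
  by move=> p /sT; rewrite mem_cat negb_or => /andP[].
have i3 : D * expect bs (fun a => (nonvan h a)%:R * weight R s (ev a h)) <= e / 5.
  apply: le_trans dD; rewrite ler_wpM2l //; apply: T3P => //.
    exact: (nested_le le3 nb).
  by move=> p /sT; rewrite mem_cat negb_or => /andP[].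
lra.
Qed.

End CommonPrimes.

(** * Periodic sets and the Euler product *)

Section Periodic.
Variables (R : realType) (A : idomainType) (nrm : A -> nat).
Hypothesis CN : counting_norm nrm.
Implicit Types (S rs : seq A) (bs : seq (seq A)) (W V : seq A -> R).

Local Notation good_box := (good_box R nrm).

Fixpoint cong (m : A) (a b : seq A) : Prop :=
  match a, b with
  | [::], [::] => True
  | x :: a', y :: b' => dvr m (x - y) /\ cong m a' b'
  | _, _ => False
  end.

Lemma cong_refl m a : cong m a a.
Proof. by elim: a => //= x a IH; split=> //; rewrite subrr; apply: dvr0. Qed.

Lemma cong_dvr m m' a b : dvr m m' -> cong m' a b -> cong m a b.
Proof.
move=> mm; elim: a b => [|x a IH] [|y b] //= [xy /IH]; split=> //.
exact: dvr_trans xy.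
Qed.

Lemma congP m a b : cong m a b -> forall i, dvr m (nth 0 a i - nth 0 b i).
Proof.
elim: a b => [|x a IH] [|y b] //=; first by move=> _ i; rewrite nth_nil subrr; apply: dvr0.
by move=> [xy /IH ab] [|i] /=.
Qed.

Definition residue_system (m : A) rs : Prop :=
  [/\ uniq rs, size rs = nrm m, forall x, exists2 r, r \in rs & dvr m (x - r) &
      {in rs &, forall r r', dvr m (r - r') -> r = r'}].

Lemma residue_system_gt0 m rs : m != 0 -> residue_system m rs -> (0 < size rs)%N.
Proof. by move=> m0 [_ -> _ _]; rewrite (nrm_gt0 CN). Qed.

Lemma sum_residue m rs (G : A -> R) x : residue_system m rs ->
  (forall x y, dvr m (x - y) -> G x = G y) ->
  G x = \sum_(r <- rs) (`[<dvr m (x - r)>])%:R * G r.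
Proof.
move=> [us _ ex inj] Gm; have [r rr xr] := ex x.
rewrite (perm_big _ (perm_to_rem rr)) big_cons (asboolT xr) mul1r (Gm _ _ xr).
rewrite big_seq big1 /= ?addr0 // => r' r'r; rewrite asboolF ?mul0r // => xr'.
have r'in := mem_rem r'r; suff rr' : r = r' by move: r'r; rewrite rr' mem_rem_uniqF.
apply: inj => //.
have -> : r - r' = (x - r') - (x - r) by rewrite opprB [RHS]addrC addrA subrK.
exact: dvrB.
Qed.

(** Each of the |m| residue classes contributes an error of at most one point of [S]. *)
Lemma avg_periodic m rs S (G : A -> R) : m != 0 -> residue_system m rs ->
  (forall x y, dvr m (x - y) -> G x = G y) -> (forall x, `|G x| <= 1) ->
  good_box S -> (0 < size S)%N ->
  `|avg S G - avg rs G| <= (nrm m)%:R / (size S)%:R.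
Proof.
move=> m0 rsP Gm G1 [_ _ SG] S0; have N0 : 0 < (size S)%:R :> R by rewrite ltr0n.
have -> : avg S G = \sum_(r <- rs) G r * ((count (fun x => `[<dvr m (x - r)>]) S)%:R / (size S)%:R).
  rewrite (eq_avg (G := fun x => \sum_(r <- rs) (`[<dvr m (x - r)>])%:R * G r)); last first.
    by move=> x _; apply: sum_residue.
  rewrite avg_sum; apply: eq_bigr => r _; rewrite -avg_count -avgZ.
  by apply: eq_avg => x _; rewrite mulrC.
have [_ szrs _ _] := rsP.
have -> : (nrm m)%:R = \sum_(r <- rs) 1 :> R by rewrite -szrs -sum1_size natr_sum.
rewrite /avg mulr_suml -sumrB mulr_suml.
apply: le_trans (ler_norm_sum _ _ _) _; apply: ler_sum => r _.
rewrite -mulrBr normrM; apply: ler_pM => //.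
have := SG m r m0; rewrite szrs; set c := _%:R.
have -> : c / (size S)%:R - (nrm m)%:R^-1 = (c - (size S)%:R / (nrm m)%:R) / (size S)%:R.
  by rewrite mulrBl mulrAC divff ?mul1r ?gt_eqF.
have N1 : 0 < (size S)%:R^-1 :> R by rewrite invr_gt0.
by rewrite normrM (gtr0_norm N1) => c1; rewrite ler_piMl // invr_ge0 ltW.
Qed.

Definition periodic m n W : Prop :=
  forall a b, size a = n -> cong m a b -> W a = W b.

Lemma expect_norm_le bs W c : {in bs, forall S, 0 < size S}%N ->
  (forall a, inbox bs a -> `|W a| <= c) -> `|expect bs W| <= c.
Proof.
move=> bs0 Wc; rewrite ler_norml; apply/andP; split.
  rewrite -(@expect_cst R A bs (- c) bs0); apply: le_expect => a /Wc.
  by rewrite ler_norml => /andP[].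
rewrite -[leRHS](@expect_cst R A bs c bs0); apply: le_expect => a /Wc.
by rewrite ler_norml => /andP[].
Qed.

Lemma expectB bs W V : expect bs (fun a => W a - V a) = expect bs W - expect bs V.
Proof.
rewrite expectD -[X in _ = _ + X]mulN1r -expectZ; congr (_ + _).
by apply: eq_expect => a _; rewrite mulN1r.
Qed.

Lemma avg_norm_le s (F : A -> R) c : (0 < size s)%N -> (forall x, `|F x| <= c) ->
  `|avg s F| <= c.
Proof.
move=> s0 Fc; have := @expect_norm_le [:: s] (fun a => F (head 0 a)) c.
by apply => // S; rewrite inE => /eqP->.
Qed.

(** Sides are exchanged for the residue system one coordinate at a time, at a cost of |m|/N each;
    averaging the head over [rs] leaves a function periodic in the other coordinates. *)
Lemma expect_periodic m rs n W : m != 0 -> residue_system m rs ->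
  periodic m n W -> (forall a, `|W a| <= 1) ->
  forall N bs, (0 < N)%N -> size bs = n -> {in bs, forall S, good_box S /\ N <= size S}%N ->
  `|expect bs W - expect (nseq n rs) W| <= (n * nrm m)%:R / N%:R.
Proof.
move=> m0 rsP; elim: n W => [|n IH] W Wm W1 N [|S bs] // N0 => [_ _|[sb] bsP].
  by rewrite subrr normr0 mul0n mul0r.
have [|SG NS] := bsP S; first exact: mem_head.
have bsP' : {in bs, forall S, good_box S /\ N <= size S}%N.
  by move=> S' S'b; apply: bsP; rewrite inE S'b orbT.
have S0 := leq_trans N0 NS.
pose W' a := avg rs (fun x => W (x :: a)).
have W'1 a : `|W' a| <= 1.
  by apply: avg_norm_le => //; apply: residue_system_gt0 rsP.
have W'm : periodic m n W'.
  move=> a b sa ab; apply: eq_avg => x _; apply: Wm => /=; first by rewrite sa.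
  by split=> //; rewrite subrr; apply: dvr0.
rewrite [expect (nseq _ _) _]/= -/(W' _) [expect (S :: bs) _]/=.
rewrite -(subrKA (expect bs W')) -expectB mulSn natrD mulrDl.
apply: le_trans (ler_normD _ _) _; apply: lerD; last exact: (IH _ W'm W'1 N).
apply: expect_norm_le => [T /bsP'[_]|a ab]; first exact: leq_trans.
apply: (@le_trans _ _ ((nrm m)%:R / (size S)%:R)).
  apply: avg_periodic => // x y xy; apply: Wm.
    by rewrite /= (size_inbox ab) sb.
  by split=> //; apply: cong_refl.
by rewrite ler_wpM2l // lef_pV2 ?posrE ?ltr0n // ler_nat.
Qed.

(** Sending z to its representatives modulo m and q is injective on [rmq] by Bezout, and the
    cardinalities agree because the norm is multiplicative. *)
Lemma avg_crt m q rm rq rmq (G : A -> A -> R) :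
  (exists u v, u * m + v * q = 1) -> m != 0 -> q != 0 ->
  residue_system m rm -> residue_system q rq -> residue_system (m * q) rmq ->
  (forall x x' y, dvr m (x - x') -> G x y = G x' y) ->
  (forall x y y', dvr q (y - y') -> G x y = G x y') ->
  avg rmq (fun z => G z z) = avg rm (fun x => avg rq (G x)).
Proof.
move=> [u [v uv1]] m0 q0 [um sm exm injm] [uq sq exq injq] [umq smq _ injmq] Gm Gq.
have [fx fxP] := choice (fun x => let: ex_intro2 r rr d := exm x in
  ex_intro (fun r => r \in rm /\ dvr m (x - r)) r (conj rr d)).
have [fy fyP] := choice (fun x => let: ex_intro2 r rr d := exq x in
  ex_intro (fun r => r \in rq /\ dvr q (x - r)) r (conj rr d)).
have us : uniq [seq (fx z, fy z) | z <- rmq].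
  rewrite map_inj_in_uniq // => z z' zr zr' [xE yE]; apply: injmq => //.
  have split_diff w : z - z' = (z - w) - (z' - w) by rewrite opprB addrA subrK.
  have mz : dvr m (z - z').
    by rewrite (split_diff (fx z)) {2}xE; apply: dvrB; [case: (fxP z)|case: (fxP z')].
  have qz : dvr q (z - z').
    by rewrite (split_diff (fy z)) {2}yE; apply: dvrB; [case: (fyP z)|case: (fyP z')].
  rewrite -[z - z']mulr1 -uv1 mulrDr; case: mz qz => [c cE] [d dE].
  apply: dvrD; first by exists (d * u); rewrite dE mulrACA (mulrC q).
  by exists (c * v); rewrite cE mulrACA.
have ut : uniq [seq (x, y) | x <- rm, y <- rq].
  by apply: allpairs_uniq => // -[x y] [x' y'] _ _ [-> ->].
have sub : {subset [seq (fx z, fy z) | z <- rmq] <= [seq (x, y) | x <- rm, y <- rq]}.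
  move=> _ /mapP[z _ ->]; apply/allpairsP; exists (fx z, fy z).
  by split=> //=; [case: (fxP z) | case: (fyP z)].
have [|szE memE] := uniq_min_size us sub.
  by rewrite size_allpairs size_map sm sq smq (nrmM CN).
have perm := uniq_perm us ut memE.
have sumE : \sum_(z <- rmq) G z z = \sum_(x <- rm) \sum_(y <- rq) G x y.
  transitivity (\sum_(xy <- [seq (fx z, fy z) | z <- rmq]) G xy.1 xy.2).
    rewrite big_map; apply: eq_bigr => z _ /=.
    by rewrite (Gm z (fx z)) ?(Gq _ z (fy z)) //; [case: (fyP z) | case: (fxP z)].
  by rewrite (perm_big _ perm) big_allpairs_dep.
have szrmq : size rmq = (size rm * size rq)%N by rewrite sm sq smq (nrmM CN).
rewrite /avg sumE szrmq natrM invfM mulrA mulrAC; congr (_ / _).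
by rewrite mulr_suml.
Qed.

Lemma avg_swap S T (F : A -> A -> R) :
  avg S (fun x => avg T (fun y => F x y)) = avg T (fun y => avg S (fun x => F x y)).
Proof.
rewrite /avg -!mulr_suml exchange_big mulrAC; congr (_ / _ / _).
Qed.

Lemma expect_avg bs S (F : A -> seq A -> R) :
  expect bs (fun b => avg S (fun x => F x b)) = avg S (fun x => expect bs (F x)).
Proof.
elim: bs F => [|T bs IH] F //=; rewrite -IH.
by apply: eq_expect => a _; apply: avg_swap.
Qed.

(** Separate arguments for the two moduli keep this shape stable: averaging out one coordinate of
    each gives a function of the same kind. *)
Lemma expect_crt m q rm rq rmq n (G : seq A -> seq A -> R) :
  (exists u v, u * m + v * q = 1) -> m != 0 -> q != 0 ->
  residue_system m rm -> residue_system q rq -> residue_system (m * q) rmq ->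
  (forall a a' b, size a = n -> size b = n -> cong m a a' -> G a b = G a' b) ->
  (forall a b b', size a = n -> size b = n -> cong q b b' -> G a b = G a b') ->
  expect (nseq n rmq) (fun a => G a a) =
  expect (nseq n rm) (fun a => expect (nseq n rq) (G a)).
Proof.
move=> uv m0 q0 rmP rqP rmqP; elim: n G => [|n IH] G Gm Gq //=.
pose G' a b := avg rm (fun x => avg rq (fun y => G (x :: a) (y :: b))).
transitivity (expect (nseq n rmq) (fun a => G' a a)).
  apply: eq_expect => a /size_inbox; rewrite size_nseq => sa.
  apply: (avg_crt (G := fun x y => G (x :: a) (y :: a)) uv m0 q0 rmP rqP rmqP).
    by move=> x x' y xx'; apply: Gm; rewrite /= ?sa //; split=> //; apply: cong_refl.
  by move=> x y y' yy'; apply: Gq; rewrite /= ?sa //; split=> //; apply: cong_refl.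
rewrite (IH G').
- apply: eq_expect => a _; rewrite -expect_avg.
  by apply: eq_expect => b _.
- move=> a a' b sa sb aa'; apply: eq_avg => x _; apply: eq_avg => y _.
  by apply: Gm => /=; rewrite ?sa ?sb //; split=> //; rewrite subrr; apply: dvr0.
- move=> a b b' sa sb bb'; apply: eq_avg => x _; apply: eq_avg => y _.
  by apply: Gq => /=; rewrite ?sa ?sb //; split=> //; rewrite subrr; apply: dvr0.
Qed.

Lemma expect_crtM m q rm rq rmq n W V :
  (exists u v, u * m + v * q = 1) -> m != 0 -> q != 0 ->
  residue_system m rm -> residue_system q rq -> residue_system (m * q) rmq ->
  periodic m n W -> periodic q n V ->
  expect (nseq n rmq) (fun a => W a * V a) = expect (nseq n rm) W * expect (nseq n rq) V.
Proof.
move=> uv m0 q0 rmP rqP rmqP Wm Vq.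
rewrite (expect_crt (m := m) (q := q) (rm := rm) (rq := rq) (G := fun a b => W a * V b)) //.
- under eq_expect do rewrite expectZ mulrC; by rewrite expectZ mulrC.
- by move=> a a' b sa sb /(Wm _ _ sa) ->.
- by move=> a b b' sa sb /(Vq _ _ sb) ->.
Qed.

End Periodic.

(** * Reduction modulo a prime and the local factors *)

Section Reduction.
Variables (A : idomainType) (p : nzprime A).

Definition reduce (x : A) : residue p := \pi_(residue p) x.

Lemma reduce_zmod : zmod_morphism reduce.
Proof. by move=> x y; rewrite /reduce [LHS]Quotient.pi_add Quotient.pi_opp. Qed.

Lemma reduce_monoid : monoid_morphism reduce.
Proof.
split=> [|x y]; rewrite /reduce; last by rewrite [LHS]Quotient.pi_mul.
by rewrite pi_oner.
Qed.

HB.instance Definition _ := GRing.isZmodMorphism.Build A (residue p) reduce reduce_zmod.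
HB.instance Definition _ := GRing.isMonoidMorphism.Build A (residue p) reduce reduce_monoid.

Lemma reduce_eq x y : reduce x = reduce y <-> in_prime p (x - y).
Proof.
rewrite /in_prime Quotient.idealrBE; split => [xy|/eqP//].
by apply/eqP.
Qed.

End Reduction.

Section LocalDensity.
Variables (R : realType) (A : idomainType) (nrm : A -> nat).
Hypothesis CN : counting_norm nrm.
Variables (n : nat) (f g : {mpoly A[n]}).
Implicit Types (p q : {classic nzprime A}) (s : seq {classic nzprime A}).

Definition eval_seq (h : {mpoly A[n]}) (a : seq A) : A :=
  meval (fun i : 'I_n => nth 0 a i) h.

Definition both (a : seq A) p : bool :=
  in_prime p (eval_seq f a) && in_prime p (eval_seq g a).

Lemma meval_map_mpoly (B : comNzRingType) (phi : {rmorphism A -> B}) (v : 'I_n -> B)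
    (h : {mpoly A[n]}) : meval v (map_mpoly phi h) = mmap phi v h.
Proof.
rewrite /map_mpoly (rmorph_mmap (mpolyC n (R:=B) \o phi : {rmorphism A -> {mpoly B[n]}})).
by apply: eq_mmap => [c|i] /=; rewrite ?mevalC ?mevalXU.
Qed.

Lemma eval_mod_reduce p h a :
  eval_mod h [ffun i : 'I_n => reduce p (nth 0 a i)] = reduce p (eval_seq h a).
Proof.
rewrite /eval_mod -[\pi_(residue p)]/(reduce p : A -> residue p) meval_map_mpoly.
by rewrite /eval_seq /meval rmorph_mmap; apply: eq_mmap => // i /=; rewrite ffunE.
Qed.

Lemma in_prime_reduce p x : in_prime p x <-> reduce p x = 0.
Proof. by rewrite -(rmorph0 (reduce p)) reduce_eq subr0. Qed.

Lemma both_zeros p a : both a p <->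
  eval_mod f [ffun i : 'I_n => reduce p (nth 0 a i)] = 0 /\
  eval_mod g [ffun i : 'I_n => reduce p (nth 0 a i)] = 0.
Proof.
rewrite !eval_mod_reduce -!in_prime_reduce.
by split=> [/andP[]|[fp gp]] //; apply/andP.
Qed.

Lemma both_periodic p a b : cong (gen CN p) a b -> both a p = both b p.
Proof.
move=> ab; apply/idP/idP; rewrite !both_zeros.
all: suff -> : [ffun i : 'I_n => reduce p (nth 0 a i)] = [ffun i : 'I_n => reduce p (nth 0 b i)] by [].
all: apply/ffunP => i; rewrite !ffunE; apply/reduce_eq/(in_primeP CN); exact: (congP ab).
Qed.

Definition local_density p : R := (zeros_mod f g p)%:R / (prime_norm p)%:R ^+ n.

Lemma size_boxpoints_nseq rs : size (boxpoints (nseq n rs : seq (seq A))) = (size rs ^ n)%N.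
Proof.
by elim: n => //= k IH; rewrite size_allpairs IH expnSr.
Qed.

(** Tuples of representatives map bijectively onto (A/p)^n, so the points counted are the common
    zeros. *)
Lemma expect_both p rs : residue_system nrm (gen CN p) rs ->
  expect (nseq n rs) (fun a => (both a p)%:R) = local_density p.
Proof.
move=> [us szrs ex inj]; rewrite expect_count size_boxpoints_nseq natrX szrs.
rewrite -(prime_normE CN) /local_density; congr (_%:R / _).
rewrite -size_filter -(size_map (fun a => [ffun i : 'I_n => reduce p (nth 0 a i)])).
apply/esym/ncard_seq.
  rewrite map_inj_in_uniq; first by apply/filter_uniq/uniq_boxpoints => S /nseqP[->].
  move=> a b; rewrite !mem_filter !mem_boxpoints => /andP[_ ar] /andP[_ br] /ffunP ab.
  have sa : size a = n by rewrite (size_inbox ar) size_nseq.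
  have sb : size b = n by rewrite (size_inbox br) size_nseq.
  have inr c i : inbox (nseq n rs) c -> (i < n)%N -> nth 0 c i \in rs.
    by rewrite /inbox; elim: (n) i c => // k IH [|i] [|x c] //= /andP[xr /IH H] // /H.
  apply: (@eq_from_nth _ 0); rewrite sa ?sb // => i ltin.
  apply: inj; rewrite ?inr //.
  by have := ab (Ordinal ltin); rewrite !ffunE /= => /reduce_eq/(in_primeP CN).
move=> x; split=> [fgx|/mapP[a]]; last by rewrite mem_filter => /andP[/both_zeros ab _] ->.
have rE (y : residue p) : exists r, r \in rs /\ reduce p r = y.
  have [r rr yr] := ex (repr y); exists r; split=> //.
  by rewrite -[RHS]reprK; apply/esym/reduce_eq/(in_primeP CN).
have [lift liftP] := choice rE.
have xE : x = [ffun i : 'I_n => reduce p (nth 0 [seq lift (x i) | i <- enum 'I_n] i)].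
  apply/ffunP => i; rewrite ffunE (nth_map i) ?size_enum_ord // nth_ord_enum.
  by case: (liftP (x i)).
rewrite xE; apply/map_f; rewrite mem_filter mem_boxpoints; apply/andP; split.
  by apply/both_zeros; rewrite -xE.
rewrite -[X in nseq X](size_enum_ord n).
elim: (enum 'I_n) => //= i t ->; rewrite andbT.
by case: (liftP (x i)).
Qed.

Lemma local_density_le1 p : 0 <= local_density p <= 1.
Proof.
have [rs rsP] := nrm_residues CN (gen_neq0 CN p).
have rs0 : (0 < size rs)%N by apply: (residue_system_gt0 CN (gen_neq0 CN p) rsP).
have bs0 : {in nseq n rs, forall S, 0 < size S}%N by move=> S /nseqP[->].
rewrite -(expect_both rsP); apply/andP; split.
  by rewrite -(expect_cst (0 : R) bs0); apply: le_expect.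
by rewrite -[leRHS](expect_cst (1 : R) bs0); apply: le_expect => a _; rewrite lern1 leq_b1.
Qed.

Definition unsieved s a : bool := all (fun p => ~~ both a p) s.

Definition modulus s : A := \prod_(p <- s) gen CN p.

Lemma modulus_neq0 s : modulus s != 0.
Proof. by rewrite /modulus prodf_seq_neq0; apply/allP => p _; apply: gen_neq0. Qed.

Lemma unsieved_periodic s : periodic (modulus s) n (fun a => (unsieved s a)%:R : R).
Proof.
move=> a b _ ab; congr (_%:R); congr nat_of_bool; apply: eq_in_all => p ps; congr (~~ _).
apply: both_periodic; apply: cong_dvr ab.
by rewrite /modulus (perm_big _ (perm_to_rem ps)) big_cons; apply/dvr_mulr/dvr_refl.
Qed.

(** The generator of [p] is coprime to the modulus of the other primes, so the Chinese remainder
    theorem splits off the factor of [p]. *)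
Lemma expect_unsieved s rs : uniq s -> residue_system nrm (modulus s) rs ->
  expect (nseq n rs) (fun a => (unsieved s a)%:R) = \prod_(p <- s) (1 - local_density p).
Proof.
elim: s rs => [|p s IH] rs /=.
  move=> _ rsP; have rs0 := residue_system_gt0 CN (modulus_neq0 _) rsP.
  by rewrite big_nil /= expect_cst // => S /nseqP[->].
move=> /andP[ps us] rsP.
have [rp rpP] := nrm_residues CN (gen_neq0 CN p).
have [rm rmP] := nrm_residues CN (modulus_neq0 s).
rewrite big_cons -(IH rm us rmP).
have -> : (fun a => (~~ both a p && unsieved s a)%:R) =
    (fun a => (1 - (both a p)%:R) * (unsieved s a)%:R) :> (seq A -> R).
  by apply/funext => a; case: (both a p); rewrite ?subrr ?mul0r ?subr0 ?mul1r.
rewrite (expect_crtM CN _ (gen_neq0 CN p) (modulus_neq0 s) rpP rmP) ?(expect_both rpP) //.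
- rewrite expectB (expect_both rpP) expect_cst // => S /nseqP[-> _].
  exact: (residue_system_gt0 CN (gen_neq0 CN p) rpP).
- apply/(coprime_no_prime CN) => -[q [qp qs]].
  have pq : p = q.
    by apply/eqP/negP => /negP/(gen_notin CN); rewrite qp.
  move: qs; rewrite -pq /modulus => {IH us rsP rmP}.
  elim: s ps => [|r s IH]; first by rewrite big_nil in_prime1.
  rewrite inE negb_or big_cons in_primeM => /andP[pr /IH ps].
  by rewrite (gen_notin CN) 1?eq_sym //= => /ps.
- by rewrite /modulus big_cons in rsP.
- by move=> a b _ ab; rewrite (both_periodic ab).
- exact: unsieved_periodic.
Qed.

Lemma unsieved_density s (e : R) : uniq s -> 0 < e -> exists2 N0, (0 < N0)%N &
  forall bs, size bs = n -> {in bs, forall S, good_box R nrm S /\ N0 <= size S}%N ->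
  `|expect bs (fun a => (unsieved s a)%:R) - \prod_(p <- s) (1 - local_density p)| <= e.
Proof.
move=> us e0; have [rs rsP] := nrm_residues CN (modulus_neq0 s).
have [N0 N00 N0P] := @exists_large R (n * nrm (modulus s))%:R e (ler0n _ _) e0.
exists N0 => // bs sbs bsP; rewrite -(expect_unsieved us rsP).
apply: le_trans (N0P N0 (leqnn _)).
apply: (expect_periodic CN (modulus_neq0 s) rsP) => //; first exact: unsieved_periodic.
by move=> a; rewrite ger0_norm // lern1 leq_b1.
Qed.

End LocalDensity.

(** * Existence of the density *)

Section Combine.
Variables (R : realType) (A : idomainType) (nrm : A -> nat).
Hypothesis CN : counting_norm nrm.
Variables (n : nat) (f g : {mpoly A[n]}).
Hypothesis fg_coprime : relatively_prime (frac_mpoly f) (frac_mpoly g).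
Implicit Types (p q : {classic nzprime A}) (s : seq {classic nzprime A}).
Implicit Types (S : 'I_n -> seq A) (e : seq 'I_n) (X : set {ffun 'I_n -> A}).

Definition point e (l : seq A) : {ffun 'I_n -> A} := [ffun i => nth 0 l (index i e)].

Definition boxset S : set {ffun 'I_n -> A} := [set a | forall i, a i \in S i].

Lemma point_inj e l l' : uniq e -> (forall i, i \in e) -> size l = n -> size l' = n ->
  point e l = point e l' -> l = l'.
Proof.
move=> ue me sl sl' /ffunP ll'; apply: (@eq_from_nth _ 0); rewrite sl ?sl' // => i ltin.
have := ll' (nth (Ordinal ltin) e i); rewrite !ffunE index_uniq //.
by rewrite (size_enumeration ue me).
Qed.

Lemma inbox_point e S l : uniq e -> (forall i, i \in e) -> size l = n ->
  inbox (map S e) l <-> boxset S (point e l).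
Proof.
move=> ue me sl; have se := size_enumeration ue me.
have {}sl : size l = size e by rewrite sl se.
have -> : boxset S (point e l) <->
    (forall j, (j < size e)%N -> forall i0, nth 0 l j \in S (nth i0 e j)).
  split=> [H j ltjn i0|H i]; last first.
    have := H (index i e) _ i; rewrite nth_index // ffunE; apply.
    by rewrite index_mem.
  by have := H (nth i0 e j); rewrite ffunE index_uniq.
elim: e l sl {ue me se} => [|i e IH] [|x l] //= [/IH{}IH]; split.
  by move=> /andP[xi /IH H] [|j] /= jn i0; rewrite ?xi ?H.
move=> H; rewrite (H 0%N isT i) /=; apply/IH => j jn i0.
by have := H j.+1 jn i0.
Qed.

Lemma ncard_boxset e S X : uniq e -> (forall i, i \in e) -> (forall i, uniq (S i)) ->
  ncard (X `&` boxset S) =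
  count (fun l => `[<X (point e l)>]) (boxpoints (map S e)).
Proof.
move=> ue me uS; rewrite -size_filter -(size_map (point e)).
have bsize l : l \in boxpoints (map S e) -> size l = n.
  by rewrite mem_boxpoints => /size_inbox; rewrite size_map (size_enumeration ue me).
apply: ncard_seq.
  rewrite map_inj_in_uniq.
    by apply/filter_uniq/uniq_boxpoints => _ /mapP[i _ ->].
  move=> l l'; rewrite !mem_filter => /andP[_ lb] /andP[_ l'b].
  by apply: point_inj => //; apply: bsize.
move=> a; split=> [[Xa Sa]|/mapP[l]]; last first.
  rewrite mem_filter => /andP[/asboolP Xl lb] ->; split=> //.
  by apply/inbox_point => //; [apply: bsize | rewrite -mem_boxpoints].
have aE : a = point e (map a e).
  by apply/ffunP => i; rewrite ffunE (nth_map i) ?index_mem // nth_index.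
rewrite aE; apply: map_f; rewrite mem_filter mem_boxpoints -aE; apply/andP; split.
  exact/asboolP.
apply/inbox_point; rewrite -?aE // size_map; exact: size_enumeration.
Qed.

Definition ratio X S : R := (ncard (X `&` boxset S))%:R / (ncard (boxset S))%:R.

Lemma ratio_expect e X S : uniq e -> (forall i, i \in e) -> (forall i, uniq (S i)) ->
  ratio X S = expect (map S e) (fun l => (`[<X (point e l)>])%:R).
Proof.
move=> ue me uS; rewrite expect_count -(ncard_boxset X ue me uS); congr (_ / _%:R).
rewrite -[boxset S]setTI (ncard_boxset _ ue me uS) -[RHS]count_predT.
by apply: eq_count => l; apply/asboolP.
Qed.

Definition sieved (p : nzprime A) (a : {ffun 'I_n -> A}) : bool :=
  in_prime p (meval a f) && in_prime p (meval a g).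

Lemma common_prime_unpack e l p : uniq e -> (forall i, i \in e) -> size l = n ->
  common_prime [:: unpack e f; unpack e g] l p = sieved p (point e l).
Proof.
move=> ue me sl; rewrite /common_prime /= andbT !ev_unpack //.
by congr (in_prime p _ && in_prime p _); apply: meval_eq => i; rewrite ffunE.
Qed.

Lemma coprime_unpack e : uniq e -> (forall i, i \in e) ->
  coprime_family [:: unpack e f; unpack e g].
Proof.
move=> ue me d dL; apply: (unpack_coprime ue me fg_coprime); apply: dL.
  by rewrite mem_head.
by rewrite !inE eqxx orbT.
Qed.

(** The order of the variables will depend on the box, but [T] and [N0] must not; with finitely many
    orders one can take a union and a maximum. *)
Lemma uniform_common_prime_small (e0 : R) (es : seq (seq 'I_n)) : 0 < e0 ->
  {in es, forall e, uniq e /\ forall i, i \in e} ->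
  exists (T : seq {classic nzprime A}) N0, (0 < N0)%N /\ forall e bs s, e \in es ->
    nested R nrm N0 bs -> size bs = n -> uniq s -> {in s, forall p, p \notin T} ->
    expect bs (fun a => (has (common_prime [:: unpack e f; unpack e g] a) s)%:R) <= e0.
Proof.
move=> e00; elim: es => [|e es IH] esP; first by exists [::], 1%N.
have [|T [N1 [N10 TP]]] := IH; first by move=> e' e'es; apply: esP; rewrite inE e'es orbT.
have [ue me] := esP e (mem_head _ _).
have [T' [N2 [N20 T'P]]] := common_prime_small CN (coprime_unpack ue me) e00.
exists (T ++ T'), (maxn N1 N2); split; first by rewrite leq_max N10.
move=> e' bs s; rewrite inE => e'P nb sb us sT.
have [sT1 sT2] : {in s, forall p, p \notin T} /\ {in s, forall p, p \notin T'}.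
  by split=> p /sT; rewrite mem_cat negb_or => /andP[].
case/predU1P: e'P => [->|e'es].
  by apply: T'P => //; apply: (nested_le _ nb); rewrite leq_maxr.
by apply: (TP e') => //; apply: (nested_le _ nb); rewrite leq_maxl.
Qed.

Lemma sorted_nested N S e : sorted (fun i j => size (S j) <= size (S i))%N e ->
  (forall i, good_box R nrm (S i) /\ (N <= size (S i))%N) -> nested R nrm N (map S e).
Proof.
move=> + SP; elim: e => //= i e IH pe; have [SG NS] := SP i; split=> //.
  move=> _ /mapP[j je ->]; apply: (allP (order_path_min _ pe) j je).
  by move=> x y z yx zy; apply: leq_trans zy yx.
by apply: IH; apply: path_sorted pe.
Qed.

Lemma expect_norm bs (W G : seq A -> R) :
  (forall a, inbox bs a -> `|W a| <= G a) -> `|expect bs W| <= expect bs G.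
Proof.
move=> WG; rewrite ler_norml -mulN1r -expectZ; apply/andP; split; apply: le_expect => a /WG.
  by rewrite ler_norml mulN1r => /andP[].
by rewrite ler_norml => /andP[].
Qed.

(** The two sets differ at points where a prime outside [T'], but none in [T'], divides both values.
    A box has finitely many points, so one witness prime per point gives a finite list, and the
    sieve bound does not depend on that list. *)
Lemma tail_small (e0 : R) : 0 < e0 ->
  exists (T : seq {classic nzprime A}) N0, (0 < N0)%N /\ forall S,
    (forall i, good_box R nrm (S i) /\ (N0 <= size (S i))%N) ->
    forall T' : seq {classic nzprime A}, {subset T <= T'} ->
    `|ratio [set a | forall p, ~~ sieved p a] S -
      ratio [set a | {in T', forall p, ~~ sieved p a}] S| <= e0.
Proof.
move=> e00; have [|T [N0 [N00 TP]]] := @uniform_common_prime_small e0 (permutations (enum 'I_n)) e00.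
  move=> e; rewrite mem_permutations => ep; rewrite (perm_uniq ep) enum_uniq; split=> // i.
  by rewrite (perm_mem ep) mem_enum.
exists T, N0; split=> // S SP T' TT'.
pose r (i j : 'I_n) := (size (S j) <= size (S i))%N.
pose e := sort r (enum 'I_n).
have ep : perm_eq e (enum 'I_n) by rewrite perm_sort.
have ue : uniq e by rewrite (perm_uniq ep) enum_uniq.
have me i : i \in e by rewrite (perm_mem ep) mem_enum.
have se : sorted r e by apply: sort_sorted => i j; rewrite /r leq_total.
have nb := sorted_nested se SP.
have uS i : uniq (S i) by case: (SP i) => -[].
rewrite !(ratio_expect _ ue me uS) -expectB.
have /choice[pick pickP] : forall l : seq A, exists q : {classic nzprime A},
    (exists p : {classic nzprime A}, (p \notin T') && sieved p (point e l)) ->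
    (q \notin T') && sieved q (point e l).
  move=> l.
  have [x xn] := nrm_gt1 CN.
  (* A default value for [pick]: some prime exists, since otherwise 0 and 0 would be coprime. *)
  have [p0 _] : exists p0 : {classic nzprime A}, True.
    apply: contrapT => nop.
    have [_ /(_ _)] := coprime_no_prime CN 0 0; case=> [[p _]|u [v]]; first by apply: nop; exists p.
    by rewrite !mulr0 addr0 => /esym/eqP; rewrite oner_eq0.
  have [[p pP]|np] := pselect (exists p, (p \notin T') && sieved p (point e l)).
    by exists p.
  by exists p0 => /np.
pose s := undup [seq pick l | l <- boxpoints (map S e) &
  `[<exists p, (p \notin T') && sieved p (point e l)>]].
have sT : {in s, forall p, p \notin T}.
  move=> p; rewrite mem_undup => /mapP[l]; rewrite mem_filter => /andP[/asboolP /pickP].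
  by move=> /andP[+ _] _ -> ; apply: contra => /TT'.
have sb : size (map S e) = n by rewrite size_map (size_enumeration ue me).
apply: le_trans (TP e _ s _ nb sb (undup_uniq _) sT); last by rewrite mem_permutations.
apply: expect_norm => l lb.
have sl : size l = n by rewrite (size_inbox lb).
have [XT|nXT] := asboolP ([set a | {in T', forall p, ~~ sieved p a}] (point e l)); last first.
  rewrite asboolF ?subrr ?normr0 // => X; apply: nXT => p _; exact: X.
have [X|/existsNP[p /negP/negPn pl]] := asboolP ([set a | forall p, ~~ sieved p a] (point e l)).
  by rewrite subrr normr0.
have ex : exists p : {classic nzprime A}, (p \notin T') && sieved p (point e l).
  by exists p; rewrite pl andbT; apply: contraL pl => /XT.
have -> : has (common_prime [:: unpack e f; unpack e g] l) s.
  apply/hasP; exists (pick l); last first.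
    by rewrite common_prime_unpack //; case/andP: (pickP _ ex).
  rewrite mem_undup; apply: map_f; rewrite mem_filter mem_boxpoints lb andbT.
  exact/asboolP.
by rewrite sub0r normrN normr1.
Qed.

Lemma partial_density (T : seq {classic nzprime A}) (e0 : R) : uniq T -> 0 < e0 ->
  exists2 N0, (0 < N0)%N & forall S,
    (forall i, good_box R nrm (S i) /\ (N0 <= size (S i))%N) ->
    `|ratio [set a | {in T, forall p, ~~ sieved p a}] S -
      \prod_(p <- T) (1 - local_density R f g p)| <= e0.
Proof.
move=> uT e00; have [N0 N00 N0P] := unsieved_density CN f g uT e00.
exists N0 => // S SP.
have me i : i \in enum 'I_n by rewrite mem_enum.
rewrite (ratio_expect _ (enum_uniq _) me) => [|i]; last by case: (SP i) => -[].
rewrite (eq_expect (G := fun l => (unsieved f g T l)%:R)); last first.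
  move=> l _; congr (nat_of_bool _)%:R; have bE p : sieved p (point (enum 'I_n) l) = both f g l p.
    by congr (in_prime p _ && in_prime p _); apply: meval_eq => i; rewrite ffunE index_enum_ord.
  by apply/asboolP/allP => H p pT; have := H p pT; rewrite bE.
apply: N0P; first by rewrite size_map size_enum_ord.
by move=> _ /mapP[i _ ->].
Qed.

Lemma prod_local_density_ge0 s : 0 <= \prod_(p <- s) (1 - local_density R f g p).
Proof.
apply: prodr_ge0 => p _; rewrite subr_ge0.
by case/andP: (local_density_le1 R CN f g p).
Qed.

(** The extra factors lie in [0, 1]. Hence the infimum over finite sets of primes is the limit along
    their net. *)
Lemma prod_local_density_mono s s' : uniq s -> uniq s' -> {subset s <= s'} ->
  \prod_(p <- s') (1 - local_density R f g p) <= \prod_(p <- s) (1 - local_density R f g p).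
Proof.
move=> us us' ss'.
have -> : \prod_(p <- s') (1 - local_density R f g p) =
    \prod_(p <- s ++ [seq p <- s' | p \notin s]) (1 - local_density R f g p).
  apply/perm_big/uniq_perm => //.
    rewrite cat_uniq us filter_uniq // andbT /=; apply/hasPn => p.
    by rewrite mem_filter => /andP[].
  move=> p; rewrite mem_cat mem_filter; case: (boolP (p \in s)) => //= ps.
  by rewrite ss'.
rewrite big_cat ler_piMr ?prod_local_density_ge0 //.
apply: prodr_ile1 => p _; rewrite subr_ge0 gerBl.
by case/andP: (local_density_le1 R CN f g p) => -> ->.
Qed.

Definition euler_limit : R := inf (range (@euler_partial A n f g R)).

Lemma euler_partial_approx (e0 : R) : 0 < e0 -> exists P0 : {fset {classic nzprime A}},
  forall s, uniq s -> {subset P0 <= s} ->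
  `|euler_limit - \prod_(p <- s) (1 - local_density R f g p)| <= e0.
Proof.
move=> e00.
have lb0 : lbound (range (@euler_partial A n f g R)) 0.
  by move=> _ [P _ <-]; apply: prod_local_density_ge0.
have ne : range (@euler_partial A n f g R) !=set0.
  by exists (@euler_partial A n f g R fset0), fset0.
have [|_ [P0 _ <-] P0lt] := @inf_adherent R (range (@euler_partial A n f g R)) e0 e00.
  by split=> //; exists 0.
exists P0 => s us P0s.
have lele : euler_limit <= \prod_(p <- s) (1 - local_density R f g p).
  apply: (@le_trans _ _ (@euler_partial A n f g R [fset p in s]%fset)).
    by apply: ge_inf; [exists 0 | exists [fset p in s]%fset].
  apply: prod_local_density_mono => //; first exact: fset_uniq.
  by move=> p ps; rewrite inE.
rewrite distrC ger0_norm ?subr_ge0 // lerBlDl.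
apply: le_trans (ltW P0lt); apply: prod_local_density_mono => //.
exact: fset_uniq.
Qed.

Lemma euler_product_limit : euler_product_is f g euler_limit.
Proof.
have FF := @totally_filter {classic nzprime A}.
apply/cvgrPdist_le => e0 /euler_partial_approx[P0 P0P].
exists P0 => // P /= P0P'; apply: P0P; first exact: fset_uniq.
by move=> p pP0; apply: (fsubsetP P0P').
Qed.

Lemma sieve_density (e0 : R) : 0 < e0 -> exists2 N0, (0 < N0)%N & forall S,
  (forall i, good_box R nrm (S i) /\ (N0 <= size (S i))%N) ->
  `|euler_limit - ratio [set a | forall p, ~~ sieved p a] S| <= e0.
Proof.
move=> e00; have e3 : 0 < e0 / 3 by rewrite divr_gt0.
have [P0 P0P] := euler_partial_approx e3.
have [T [N1 [N10 TP]]] := tail_small e3.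
(* The list must be large both for the Euler product ([P0]) and for the tail ([T]). *)
pose s := undup (P0 ++ T).
have us : uniq s by apply: undup_uniq.
have [N2 N20 sP] := partial_density us e3.
exists (maxn N1 N2) => [|S SP]; first by rewrite leq_max N10.
have S1 i : good_box R nrm (S i) /\ (N1 <= size (S i))%N.
  by have [SG] := SP i; rewrite geq_max => /andP[].
have S2 i : good_box R nrm (S i) /\ (N2 <= size (S i))%N.
  by have [SG] := SP i; rewrite geq_max => /andP[].
have := sP S S2; have := TP S S1 s; have := P0P s us.
set x := \prod_(p <- s) _; set y := ratio _ S; set z := ratio _ S => H1 H2 H3.
rewrite -(subrKA x) -[x - y](subrKA z); apply: le_trans (ler_normD _ _) _.
have -> : e0 = e0 / 3 + (e0 / 3 + e0 / 3) by lra.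
apply: lerD; first by apply: H1 => p pP0; rewrite mem_undup mem_cat pP0.
apply: le_trans (ler_normD _ _) _; rewrite lerD //; first by rewrite distrC.
by rewrite distrC; apply: H2 => p pT; rewrite mem_undup mem_cat pT orbT.
Qed.

Lemma all_pinfty_filter : Filter (@all_pinfty R n).
Proof.
apply: filter_fromT_filter; first by exists 0.
move=> M M'; exists (Num.max M M') => B MB; split=> i; apply: le_trans (MB i).
  by rewrite le_max lexx.
by rewrite le_max lexx orbT.
Qed.

(* [side x] lists the elements allowed in a coordinate whose bound is [x]. *)
Theorem coprime_density (box : ('I_n -> R) -> set {ffun 'I_n -> A}) (side : R -> seq A)
    (X : set {ffun 'I_n -> A}) :
  (forall B, (forall i, 1 <= B i) -> box B = boxset (fun i => side (B i))) ->
  (forall x, 1 <= x -> good_box R nrm (side x)) ->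
  (forall N, exists M, forall x, M <= x -> (N <= size (side x))%N) ->
  (forall a, X a <-> exists u v, u * meval a f + v * meval a g = 1) ->
  exists l : R, euler_product_is f g l /\ density_is box X l.
Proof.
move=> boxE sideG side_large XE; exists euler_limit; split; first exact: euler_product_limit.
have FF := all_pinfty_filter; apply/cvgrPdist_le => e0 /sieve_density[N0 N00 N0P].
have [M MP] := side_large N0.
(* The box is known to be a product of sides only for bounds at least 1. *)
exists (Num.max 1 M) => // B /= BM.
have B1 i : 1 <= B i by apply: le_trans (BM i); rewrite le_max lexx.
have -> : X = [set a | forall p, ~~ sieved p a].
  apply/seteqP; split=> a /=; rewrite XE (coprime_no_prime CN) => H.
    by move=> p; apply/negP => /andP[fp gp]; apply: H; exists p.
  by move=> [p [fp gp]]; have := H p; rewrite /sieved fp gp.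
rewrite boxE //; apply: N0P => i; split; first exact: sideG.
by apply: MP; apply: le_trans (BM i); rewrite le_max lexx orbT.
Qed.

End Combine.

(** * The integers and polynomials over a finite field *)

Lemma dvr_intP (m x : int) : dvr m x <-> (m %| x)%Z.
Proof. by split=> [[c ->]|/dvdzP]; rewrite ?dvdz_mull. Qed.

(** The right-hand side is the ceiling of (b - rho)/M, written so that b - rho is never
    truncated. *)
Lemma count_residue_iota (M rho b : nat) : (rho < M)%N ->
  count (fun i => i %% M == rho)%N (iota 0 b) = ((b + (M - rho).-1) %/ M)%N.
Proof.
move=> rM; have M0 : (0 < M)%N by apply: leq_ltn_trans rM.
elim: b => [|b IH]; first by rewrite add0n divn_small // prednK ?subn_gt0 // leq_subr.
rewrite -addn1 iotaD count_cat IH /= addn0 add0n addn1 addSn divnS // addnC; congr (_ + _)%N.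
rewrite -addnS prednK ?subn_gt0 //; congr nat_of_bool.
rewrite -{1}[rho](modn_small rM) -(eqn_modDr (M - rho)) subnKC ?modnn //.
exact: ltnW.
Qed.

Lemma counting_norm_int : counting_norm absz.
Proof.
split.
- by move=> x; rewrite absz_eq0.
- exact: abszM.
- by move=> x y; lia.
- by move=> x x1; apply/unitrP; exists x; split; nia.
- move=> a b; have [u [v uvE]] := Bezoutz a b; exists u, v; rewrite uvE.
  by split; apply/dvr_intP; rewrite ?dvdz_gcdl ?dvdz_gcdr.
- move=> m m0; exists [seq i%:Z | i <- iota 0 `|m|%N]; split.
  + by rewrite map_inj_uniq ?iota_uniq // => i j [].
  + by rewrite size_map size_iota.
  + move=> x; exists (x %% m)%Z; last by exists (x %/ m)%Z; rewrite {1}(divz_eq x m) addrK.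
    have := modz_ge0 x m0; have := ltz_mod x m0; case: (x %% m)%Z => // k km _.
    by apply: map_f; rewrite mem_iota; lia.
  + move=> _ _ /mapP[i + ->] /mapP[j + ->]; rewrite !mem_iota => /andP[_ im] /andP[_ jm].
    move=> /dvr_intP; rewrite -eqz_mod_dvd => /eqP.
    by rewrite -(modz_abs i) -(modz_abs j) !modz_nat !modn_small.
(* There are 2X + 1 <= 3X integers of absolute value at most X. *)
- exists 3%N => // X s X0 us sX.
  apply: (@leq_trans (size [seq (i%:Z - X%:Z)%R | i <- iota 0 (2 * X).+1])).
    apply: uniq_leq_size => // x /sX xX; apply/mapP; exists (absz (x + X%:Z)); last by lia.
    by rewrite mem_iota; lia.
  by rewrite size_map size_iota; lia.
- by exists 2.
Qed.

Definition side_int (R : realType) (x : R) : seq int :=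
  [seq i.+1%:Z | i <- iota 0 (Num.trunc x)].

(** The difference is (k - t)/M with t the remainder, and both k and t lie between 0 and M. *)
Lemma dist_divn (R : realType) (b k M : nat) : (k < M)%N ->
  `|((b + k) %/ M)%:R - b%:R / M%:R| <= 1 :> R.
Proof.
move=> kM; have M0 : (0 < M)%N by apply: leq_ltn_trans kM.
have M0R : 0 < M%:R :> R by rewrite ltr0n.
have := divn_eq (b + k) M; have := ltn_pmod (b + k) M0.
move: (_ %/ _)%N (_ %% _)%N => c t tM E.
have -> : c%:R - b%:R / M%:R = (c * M)%:R / M%:R - b%:R / M%:R :> R.
  by rewrite natrM mulfK ?gt_eqF.
rewrite -mulrBl normrM (gtr0_norm (_ : 0 < M%:R^-1)) ?invr_gt0 // ler_pdivrMr // mul1r.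
have kR : k%:R <= M%:R :> R by rewrite ler_nat ltnW.
have tR : t%:R <= M%:R :> R by rewrite ler_nat ltnW.
have ER : b%:R + k%:R = (c * M)%:R + t%:R :> R by rewrite -!natrD E.
have k0 : 0 <= k%:R :> R by [].
have t0 : 0 <= t%:R :> R by [].
by rewrite ler_norml; apply/andP; split; lra.
Qed.

Lemma good_side_int (R : realType) (x : R) : good_box R absz (side_int x).
Proof.
rewrite /side_int; set b := Num.trunc x; split.
- by rewrite map_inj_uniq ?iota_uniq // => i j [].
- by move=> _ /mapP[i + ->]; rewrite mem_iota size_map size_iota; lia.
- move=> m r m0; rewrite size_map size_iota count_map.
  have M0 : (0 < `|m|)%N by rewrite absz_gt0.
  (* The entries of the side are i + 1, so the condition on i is modulo r - 1. *)
  have := modz_ge0 (r - 1) m0; have := ltz_mod (r - 1) m0.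
  case E : ((r - 1) %% m)%Z => [rho|] // rhom _.
  have rhoM : (rho < `|m|)%N by lia.
  rewrite (eq_count (a2 := fun i => i %% `|m| == rho)%N); last first.
    move=> i /=; apply/asboolP/eqP.
      move/dvr_intP; have -> : i.+1%:Z - r = i%:Z - (r - 1) by lia.
      rewrite -eqz_mod_dvd E => /eqP.
      by rewrite -modz_abs => /esym; rewrite modz_nat => -[].
    move=> iE; apply/dvr_intP; have -> : i.+1%:Z - r = i%:Z - (r - 1) by lia.
    by rewrite -eqz_mod_dvd E -modz_abs modz_nat iE.
  rewrite count_residue_iota //; apply: dist_divn.
  by rewrite prednK ?subn_gt0 // leq_subr.
Qed.

Lemma mem_side_int (R : realType) (x : R) a : (a \in side_int x) = (0 < a) && (a%:~R <= x).
Proof.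
apply/mapP/andP => [[i + ->]|[]].
  by rewrite mem_iota add0n => /andP[_]; rewrite truncn_gt_nat.
case: a => // -[//|n] _ nx; exists n => //.
by rewrite mem_iota add0n /= truncn_gt_nat.
Qed.

Theorem coprime_density_int (R : realType) (n : nat) (f g : {mpoly int[n]}) :
  relatively_prime (frac_mpoly f) (frac_mpoly g) ->
  exists l : R, euler_product_is f g l /\
    density_is (@boxZ R n)
      [set a : {ffun 'I_n -> int} | gcdz (meval a f) (meval a g) = 1] l.
Proof.
move=> fg; apply: (coprime_density counting_norm_int fg (side := @side_int R)).
- move=> B _; apply/seteqP; split=> a H i; have := H i; rewrite mem_side_int.
    by case=> -> ->.
  by move=> /andP.
- by move=> x _; apply: good_side_int.
- move=> N; exists N%:R => x Nx; rewrite size_map size_iota.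
  by rewrite truncn_ge_nat // (le_trans _ Nx).
- move=> a; split=> [/eqP/coprimezP[[u v] /= uv1]|[u [v uv1]]]; first by exists u, v.
  by apply/eqP/coprimezP; exists (u, v).
Qed.

Section FqPoly.
Variable F : finFieldType.
Local Notation q := #|F|.
Implicit Types (x y m r : {poly F}).

Let q_gt1 : (1 < q)%N.
Proof. by rewrite (cardD1 0) (cardD1 1) !inE oner_eq0. Qed.

Lemma card_field_gt0 : (0 < q)%N.
Proof. exact: ltnW. Qed.

Definition poly_norm x : nat := if x == 0 then 0%N else (q ^ (size x).-1)%N.

Definition polys_upto (d : nat) : seq {poly F} := [seq rVpoly v | v <- enum 'rV[F]_d].

Lemma size_polys_upto d : size (polys_upto d) = (q ^ d)%N.
Proof. by rewrite size_map -cardE card_mx mul1n. Qed.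

Lemma uniq_polys_upto d : uniq (polys_upto d).
Proof. by rewrite map_inj_uniq ?enum_uniq //; apply: can_inj rVpolyK. Qed.

Lemma mem_polys_upto d x : (x \in polys_upto d) = (size x <= d)%N.
Proof.
apply/mapP/idP => [[v _ ->]|xd]; first exact: size_poly.
by exists (poly_rV x); rewrite ?mem_enum ?poly_rV_K.
Qed.

Lemma poly_norm_le x d : (size x <= d)%N -> (poly_norm x <= q ^ d)%N.
Proof.
move=> xd; rewrite /poly_norm; case: ifP => // _.
by rewrite leq_exp2l // (leq_trans (leq_pred _)).
Qed.

Lemma poly_normE x : x != 0 -> poly_norm x = (q ^ (size x).-1)%N.
Proof. by rewrite /poly_norm => /negbTE ->. Qed.

Lemma size_small_dvd m x : dvr m x -> (size x < size m)%N -> x = 0.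
Proof.
move=> [c ->]; have [->|c0] := eqVneq c 0; first by rewrite mul0r.
have [->|m0] := eqVneq m 0; first by rewrite mulr0.
rewrite size_mul // -subn1 ltn_subLR; last by rewrite addn_gt0 !size_poly_gt0 c0.
by rewrite ltn_add2r ltnS leqn0 size_poly_eq0 (negbTE c0).
Qed.

Lemma polys_residue_inj d m x y : m != 0 -> (d < size m)%N ->
  x \in polys_upto d -> y \in polys_upto d -> dvr m (x - y) -> x = y.
Proof.
move=> m0 dm; rewrite !mem_polys_upto => xd yd /size_small_dvd xy.
apply/eqP; rewrite -subr_eq0; apply/eqP/xy; apply: leq_ltn_trans dm.
by rewrite (leq_trans (size_polyD _ _)) // size_polyN geq_max xd.
Qed.

Lemma counting_norm_poly : counting_norm poly_norm.
Proof.
have q0 e : (0 < q ^ e)%N by rewrite expn_gt0 card_field_gt0.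
split.
- move=> x; rewrite /poly_norm; case: (x == 0) => //.
  by apply/eqP => H; have := q0 (size x).-1; rewrite H.
- move=> x y; rewrite /poly_norm mulf_eq0.
  have [//|x0] := eqVneq x 0; have [//|y0] := eqVneq y 0; first by rewrite muln0.
  rewrite /= -expnD size_mul //; congr (_ ^ _)%N.
  by move: x0 y0; rewrite -!size_poly_gt0; case: (size x) => // a; case: (size y) => // b _ _; rewrite addnS.
(* The norm is ultrametric: the larger of the two norms already bounds that of the sum. *)
- move=> x y; wlog xy : x y / (size y <= size x)%N.
    move=> H; have [/H//|/ltnW/H] := leqP (size y) (size x).
    by rewrite addrC addnC.
  have [->|x0] := eqVneq x 0; first by rewrite add0r leq_addl.
  apply: leq_trans (leq_addr _ _); rewrite /poly_norm (negbTE x0).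
  case: ifP => // _; rewrite leq_exp2l // -!subn1 leq_sub2r //.
  by rewrite (leq_trans (size_polyD _ _)) // geq_max leqnn.
- move=> x; rewrite /poly_norm; case: eqVneq => // x0 x1.
  have sx : (size x).-1 == 0%N by rewrite -(eqn_exp2l _ _ q_gt1) x1.
  have /size_poly1P[c c0 ->] : size x == 1%N.
    by rewrite -(prednK (_ : 0 < size x)%N) ?size_poly_gt0 // (eqP sx).
  by rewrite poly_unitE coefC size_polyC c0 unitfE c0.
- move=> a b; have [[u v] /= uvE] := Bezoutp a b; exists u, v.
  by split; apply/Pdiv.Field.dvdpP; rewrite (eqp_dvdl _ uvE) ?dvdp_gcdl ?dvdp_gcdr.
- move=> m m0; exists (polys_upto (size m).-1); split.
  + exact: uniq_polys_upto.
  + by rewrite size_polys_upto poly_normE.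
  + move=> x; exists (x %% m); last first.
      by exists (x %/ m); rewrite {1}(divp_eq x m) addrK.
    by rewrite mem_polys_upto -ltnS prednK ?size_poly_gt0 // ltn_modp.
  + move=> x y xm ym; apply: polys_residue_inj xm ym => //.
    by rewrite prednK // size_poly_gt0.
(* If q^e is the largest power of q up to X, the polynomials of norm at most X have size at most e +
   1, and there are q^(e+1) <= qX of them. *)
- exists q; first exact: card_field_gt0.
  move=> X s X0 us sX; pose e := trunc_log q X.
  apply: (@leq_trans (size (polys_upto e.+1))); last first.
    by rewrite size_polys_upto expnS leq_mul2l trunc_logP ?orbT.
  apply: uniq_leq_size => // x /sX; rewrite mem_polys_upto /poly_norm.
  have [->|x0] := eqVneq x 0; first by rewrite size_poly0.
  move=> xX; have := leq_ltn_trans xX (trunc_log_ltn X q_gt1).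
  by rewrite ltn_exp2l // prednK // size_poly_gt0.
- by exists 'X; rewrite /poly_norm polyX_eq0 size_polyX expn1.
Qed.

(** Let e be the degree of m. If e <= d, a class modulo m meets the side in exactly q^(d-e) points,
    namely r mod m + y m with y of size at most d - e. If e > d it meets the side at most once, and
    q^(d-e) is below 1. *)
Lemma good_polys_upto (R : realType) d : good_box R poly_norm (polys_upto d).
Proof.
split; first exact: uniq_polys_upto.
  by move=> x; rewrite mem_polys_upto size_polys_upto; apply: poly_norm_le.
move=> m r m0; rewrite poly_normE // size_polys_upto.
have q0 e : 0 < (q ^ e)%:R :> R by rewrite ltr0n expn_gt0 card_field_gt0.
set e := (size m).-1; have sm : size m = e.+1 by rewrite prednK // size_poly_gt0.
pose s := [seq x <- polys_upto d | `[<dvr m (x - r)>]].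
rewrite -size_filter -/s.
have us : uniq s by rewrite filter_uniq // uniq_polys_upto.
have [ed|de] := leqP e d; last first.
  have s1 : (size s <= 1)%N.
    rewrite leqNgt; apply/negP => s2.
    have s0 : (0 < size s)%N by apply: ltnW.
    have := mem_nth 0 s0; have := mem_nth 0 s2; rewrite !mem_filter.
    move=> /andP[/asboolP yr yd] /andP[/asboolP xr xd].
    have /eqP : nth 0 s 0 = nth 0 s 1.
      apply: (@polys_residue_inj d m) => //; first by rewrite sm ltnW.
      have -> : nth 0 s 0 - nth 0 s 1 = (nth 0 s 0 - r) - (nth 0 s 1 - r).
        by rewrite opprB addrA subrK.
      exact: dvrB.
    by rewrite nth_uniq.
  have : (q ^ d)%:R / (q ^ e)%:R <= 1 :> R.
    by rewrite ler_pdivrMr // mul1r ler_nat leq_exp2l // ltnW.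
  have : 0 <= (q ^ d)%:R / (q ^ e)%:R :> R by rewrite divr_ge0.
  have : (size s)%:R <= 1 :> R by rewrite lern1.
  have : 0 <= (size s)%:R :> R by [].
  by move=> *; rewrite ler_norml; apply/andP; split; lra.
suff -> : size s = (q ^ (d - e))%N.
  by rewrite -(subnK ed) expnD natrM mulfK ?gt_eqF // addnK subrr normr0.
rewrite -size_polys_upto -(size_map (fun y => r %% m + y * m)).
have addm_inj : injective (fun y => r %% m + y * m).
  by move=> y y' /addrI /(mulIf m0).
have rm : (size (r %% m)%R <= e)%N by rewrite -ltnS -sm ltn_modp.
have szM y : y != 0 -> size (y * m) = (size y + e)%N.
  by move=> y0; rewrite size_mul // sm addnS.
apply/perm_size/uniq_perm => //; first by rewrite map_inj_uniq ?uniq_polys_upto.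
move=> x; rewrite mem_filter mem_polys_upto; apply/andP/mapP.
  move=> [/asboolP[c xE] xd]; exists (c + r %/ m); last first.
    by rewrite mulrDl -xE addrCA [_ %% _ + _]addrC -divp_eq subrK.
  have [->|y0] := eqVneq (c + r %/ m) 0; first by rewrite mem_polys_upto size_poly0.
  rewrite mem_polys_upto -(leq_add2r e) subnK // -szM //.
  have -> : (c + r %/ m) * m = x - r %% m.
    by apply/eqP; rewrite eq_sym subr_eq mulrDl -xE -addrA -divp_eq subrK.
  by rewrite (leq_trans (size_polyD _ _)) // size_polyN geq_max xd (leq_trans rm).
move=> [y]; rewrite mem_polys_upto => yd ->; split.
  apply/asboolP; exists (y - r %/ m); rewrite mulrBl {2}(divp_eq r m).
  by rewrite opprD [_ + y * m]addrC addrACA subrr addr0.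
rewrite (leq_trans (size_polyD _ _)) // geq_max (leq_trans rm) //=.
have [->|y0] := eqVneq y 0; first by rewrite mul0r size_poly0.
by rewrite szM // -(subnK ed) leq_add2r.
Qed.

(** Norms of nonzero polynomials are powers of q, so x matters only through the integer part of its
    logarithm, which bounds the degree; the size is one more. For x < 1 the constants would still be
    listed, hence the condition 1 <= x below. *)
Definition side_poly (R : realType) (x : R) : seq {poly F} :=
  polys_upto (trunc_log q (Num.trunc x)).+1.

Lemma mem_side_poly (R : realType) (x : R) a : 1 <= x ->
  (a \in side_poly x) = ((poly_norm a)%:R <= x).
Proof.
move=> x1; have x0 : 0 <= x := le_trans ler01 x1.
have t0 : (0 < Num.trunc x)%N by rewrite truncn_gt0.
rewrite mem_polys_upto -truncn_ge_nat // /poly_norm.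
have [->|a0] := eqVneq a 0; first by rewrite size_poly0.
have -> : (size a <= (trunc_log q (Num.trunc x)).+1)%N =
    ((size a).-1 <= trunc_log q (Num.trunc x))%N.
  by rewrite -{1}(prednK (_ : 0 < size a)%N) ?size_poly_gt0.
apply/idP/idP => [|H].
  by rewrite -(leq_exp2l _ _ q_gt1) => /leq_trans; apply; apply: trunc_logP.
by rewrite -ltnS -(ltn_exp2l _ _ q_gt1); apply: leq_ltn_trans H (trunc_log_ltn _ q_gt1).
Qed.

Theorem coprime_density_poly (R : realType) (n : nat) (f g : {mpoly {poly F}[n]}) :
  relatively_prime (frac_mpoly f) (frac_mpoly g) ->
  exists l : R, euler_product_is f g l /\
    density_is (@boxFqt F R n)
      [set a : {ffun 'I_n -> {poly F}} | coprimep (meval a f) (meval a g)] l.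
Proof.
move=> fg; apply: (coprime_density counting_norm_poly fg (side := @side_poly R)).
- move=> B B1; apply/seteqP; split=> a H i; have := H i.
    by rewrite mem_side_poly // -(elt_normE counting_norm_poly).
  by rewrite mem_side_poly // -(elt_normE counting_norm_poly).
- by move=> x _; apply: good_polys_upto.
- move=> N; exists N%:R => x Nx; rewrite size_polys_upto.
  apply: leq_trans (ltnW (trunc_log_ltn _ q_gt1)).
  by rewrite truncn_ge_nat // (le_trans _ Nx).
- move=> a; split=> [/Bezout_eq1_coprimepP[[u v] /= uv1]|[u [v uv1]]]; first by exists u, v.
  by apply/Bezout_eq1_coprimepP; exists (u, v).
Qed.

End FqPoly.

Theorem theorem3p1 (R : realType) :
  (forall (n : nat) (f g : {mpoly int[n]}),
     relatively_prime (frac_mpoly f) (frac_mpoly g) ->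
     exists l : R,
       euler_product_is f g l /\
       density_is (@boxZ R n)
         [set a : {ffun 'I_n -> int} |
            gcdz (meval a f) (meval a g) = 1] l) /\
  (forall (F : finFieldType) (n : nat) (f g : {mpoly {poly F}[n]}),
     relatively_prime (frac_mpoly f) (frac_mpoly g) ->
     exists l : R,
       euler_product_is f g l /\
       density_is (@boxFqt F R n)
         [set a : {ffun 'I_n -> {poly F}} |
            coprimep (meval a f) (meval a g)] l).
Proof.
by split=> [n f g|F n f g]; [apply: coprime_density_int | apply: coprime_density_poly].
Qed.
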